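(* Let $n\ge1$, $m>1$, let $\mathcal{Z}=\{z_i\}_{i=1}^m$ be distinct points of $\mathbb{B}^n$ and $\mathcal{W}=\{w_i\}_{i=1}^m\subset\mathbb{D}$, with the $w_i$ not all equal, and suppose that some function in $\mathcal{S}(\mathbb{B}^n)$ interpolates $\mathcal{Z}$ and $\mathcal{W}$. Define $$\lambda_{\mathcal{Z},\mathcal{W}}=\inf\{\|\eta\|_\infty:\eta\in\mathcal{S}(\mathbb{B}^n)\text{ interpolates }\mathcal{Z}\text{ and }\mathcal{W}\}.$$ Then there exists an extremal function $\varphi\in\mathcal{E}(\mathbb{B}^n)$ such that $\lambda_{\mathcal{Z},\mathcal{W}}\,\varphi$ interpolates $\mathcal{Z}$ and $\mathcal{W}$.
   Context: $\mathbb{B}^n$ is the open unit ball of $\mathbb{C}^n$, $\mathbb{D}=\mathbb{B}^1$. $H^\infty(\mathbb{B}^n)$: bounded analytic functions on $\mathbb{B}^n$ with sup norm $\|\cdot\|_\infty$; $\mathcal{S}(\mathbb{B}^n)$: its closed unit ball. A function $\varphi\in\mathcal{S}(\mathbb{B}^n)$ interpolates data $\mathcal{Z}=\{z_i\}_{i=1}^m$, $\mathcal{W}=\{w_i\}_{i=1}^m$ if $\varphi(z_i)=w_i$ for all $i$. Data ($z_i\in\mathbb{B}^n$ distinct, $w_i\in\mathbb{D}$) solve the extremal problem if at least one $\varphi\in\mathcal{S}(\mathbb{B}^n)$ interpolates them and every interpolating $\varphi\in\mathcal{S}(\mathbb{B}^n)$ satisfies $\|\varphi\|_\infty=1$. $\mathcal{E}(\mathbb{B}^n)$,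 the set of extremal functions, is the set of all $\varphi\in\mathcal{S}(\mathbb{B}^n)$ that interpolate some data (with any finite number of nodes) which solve the extremal problem. *)

(* Defs.v *)
From HB Require Import structures.
From mathcomp Require Import all_boot all_order all_algebra.
From mathcomp Require Import complex.
From mathcomp Require Import all_classical all_reals all_analysis.

Set Implicit Arguments.
Unset Strict Implicit.
Unset Printing Implicit Defensive.

Import Order.TTheory GRing.Theory Num.Theory.
Import numFieldNormedType.Exports.

Local Open Scope classical_set_scope.
Local Open Scope ring_scope.
Local Open Scope complex_scope.

(* [R[i]] is partially ordered by x <= y <-> y - x is a nonnegative real, and
   the norm of a complex number is an element of R[i] (with zero imaginary
   part), so [x < 1] is the usual inequality for a sum of norms. *)

(* R[i], typed so that it inherits the topology and the structure of normed space
   over itself that every numClosedFieldType has; these are not found on R[i]. *)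
Definition cplx (R : realType) : numClosedFieldType := R[i].

(* The ball is Euclidean; the norm of the library on 'rV is the max norm, which
   induces the same topology and is only used through [differentiable]. *)
Definition cball (R : realType) (n : nat) : set 'rV[cplx R]_n :=
  [set z : 'rV[cplx R]_n | \sum_(j < n) `|z 0 j| ^+ 2 < 1].

(* Functions on the ball are represented by total functions whose values outside
   the ball are never used.  [differentiable] is Frechet differentiability over
   the field R[i], that is, complex differentiability. *)
Definition analytic_on_ball (R : realType) (n : nat)
    (f : 'rV[cplx R]_n -> cplx R) : Prop :=
  forall z, cball z -> differentiable f z.

Definition bounded_on_ball (R : realType) (n : nat)
    (f : 'rV[cplx R]_n -> cplx R) : Prop :=
  exists M : R, forall z, cball z -> complex.Re `|f z| <= M.

Definition Hinfty (R : realType) (n : nat) : set ('rV[cplx R]_n -> cplx R) :=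
  [set f | analytic_on_ball f /\ bounded_on_ball f].

Definition supnorm (R : realType) (n : nat) (f : 'rV[cplx R]_n -> cplx R) : R :=
  sup [set complex.Re `|f z| | z in @cball R n].

Definition schur (R : realType) (n : nat) : set ('rV[cplx R]_n -> cplx R) :=
  [set f | Hinfty f /\ supnorm f <= 1].

Definition pick_data (R : realType) (n m : nat)
    (z : 'I_m -> 'rV[cplx R]_n) (w : 'I_m -> cplx R) : Prop :=
  [/\ injective z, forall i, cball (z i) & forall i, `|w i| < 1].

Definition interpolants (R : realType) (n m : nat)
    (z : 'I_m -> 'rV[cplx R]_n) (w : 'I_m -> cplx R) :
  set ('rV[cplx R]_n -> cplx R) :=
  [set f | schur f /\ forall i, f (z i) = w i].

Definition solves_extremal (R : realType) (n m : nat)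
    (z : 'I_m -> 'rV[cplx R]_n) (w : 'I_m -> cplx R) : Prop :=
  interpolants z w !=set0 /\
  forall f, interpolants z w f -> supnorm f = 1.

Definition extremal (R : realType) (n : nat) : set ('rV[cplx R]_n -> cplx R) :=
  [set f | exists (m : nat) (z : 'I_m -> 'rV[cplx R]_n) (w : 'I_m -> cplx R),
     [/\ pick_data z w, solves_extremal z w & interpolants z w f]].

Definition lambda_inf (R : realType) (n m : nat)
    (z : 'I_m -> 'rV[cplx R]_n) (w : 'I_m -> cplx R) : R :=
  inf [set supnorm f | f in interpolants z w].

(* Main.v *)
Require Import Defs.
From HB Require Import structures.
From mathcomp Require Import all_boot all_order all_algebra.
From mathcomp Require Import complex.
From mathcomp Require Import all_classical all_reals all_analysis.
From mathcomp Require Import zify ring lra.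

(* A minimizing sequence of interpolants has a limit f, analytic on the ball and
   bounded by lambda, that still interpolates. As w is not constant, the strict
   maximum principle gives |w_i| < lambda, and f / lambda is extremal: an
   interpolant g of w / lambda makes lambda g compete in the infimum.

   Cauchy's theorem is obtained without integrals. Riemann sums of f(zeta) dzeta over
   the boundary of a square, with 2^N nodes per side, are exactly additive under
   quadrisection, so Goursat's bisection argument shows that they tend to 0. Applied
   to q(e^zeta), which is periodic, this gives the mean value property on circles, in
   the limit of means over roots of unity, for q continuous and differentiable off one
   point. For q(t) = t (g(t) - g(a)) / (t - a) it becomes Cauchy's formula, hence a
   quadratic bound on the first-order Taylor remainder that depends only on a bound
   for g. Such a bound survives limits along an ultrafilter, which is all that is
   needed of Montel's theorem. *)

Set Implicit Arguments.
Unset Strict Implicit.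
Unset Printing Implicit Defensive.

Import Order.TTheory GRing.Theory Num.Theory.
Import numFieldNormedType.Exports.

Local Open Scope classical_set_scope.
Local Open Scope ring_scope.
Local Open Scope complex_scope.

(** * The modulus of a complex number as an element of [R] *)

Section Modulus.
Variable R : realType.
Implicit Types z w : R[i].

(** The norm on [R[i]] takes values in [R[i]], which is only partially ordered; with values in [R],
    real inequalities apply directly. *)
Definition cmod z : R := Normc.normc z.

Lemma cmodE z : cmod z = Num.sqrt (complex.Re z ^+ 2 + complex.Im z ^+ 2).
Proof. by case: z. Qed.

Lemma cmodM z w : cmod (z * w) = cmod z * cmod w.
Proof. exact: Normc.normcM. Qed.

Lemma cmodV z : cmod z^-1 = (cmod z)^-1.
Proof. exact: Normc.normcV. Qed.

Lemma cmodN z : cmod (- z) = cmod z.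
Proof. exact: normcN. Qed.

Lemma cmodB z w : cmod (z - w) = cmod (w - z).
Proof. by rewrite -cmodN opprB. Qed.

Lemma cmod_ge0 z : 0 <= cmod z.
Proof. by rewrite cmodE sqrtr_ge0. Qed.

Lemma cmod0 : cmod 0 = 0.
Proof. exact: Normc.normc0. Qed.

Lemma cmod_eq0 z : (cmod z == 0) = (z == 0).
Proof.
by apply/eqP/eqP => [/Normc.eq0_normc|->] //; exact: cmod0.
Qed.

Lemma cmod_gt0 z : (0 < cmod z) = (z != 0).
Proof. by rewrite lt_def cmod_ge0 andbT cmod_eq0. Qed.

Lemma cmodD z w : cmod (z + w) <= cmod z + cmod w.
Proof. exact: le_normcD. Qed.

Lemma cmod_real (x : R) : cmod x%:C = `|x|.
Proof. by rewrite cmodE /= expr0n /= addr0 sqrtr_sqr. Qed.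

Lemma cmod_sqr z : cmod z ^+ 2 = complex.Re z ^+ 2 + complex.Im z ^+ 2.
Proof. by rewrite cmodE sqr_sqrtr // addr_ge0 // sqr_ge0. Qed.

Lemma Re_le_cmod z : `|complex.Re z| <= cmod z.
Proof.
by rewrite cmodE -sqrtr_sqr ler_wsqrtr // lerDl sqr_ge0.
Qed.

Lemma Im_le_cmod z : `|complex.Im z| <= cmod z.
Proof. by rewrite cmodE -sqrtr_sqr ler_wsqrtr // lerDr sqr_ge0. Qed.

Lemma ReD z w : complex.Re (z + w) = complex.Re z + complex.Re w.
Proof. by case: z => ? ?; case: w. Qed.

Lemma Re_realM (x : R) z : complex.Re (x%:C * z) = x * complex.Re z.
Proof. by case: z => a b; simpc. Qed.

Lemma cmod_i : cmod 'i = 1.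
Proof. by rewrite cmodE /= expr0n /= add0r expr1n sqrtr1. Qed.

Lemma cmod_half z : cmod (z / 2) = cmod z / 2.
Proof.
have -> : (2 : R[i]) = (2 : R)%:C by rewrite rmorph_nat.
by rewrite cmodM cmodV cmod_real ger0_norm.
Qed.

Lemma cmod_Complex (x y : R) : cmod (x +i* y) <= `|x| + `|y|.
Proof.
have := cmodD x%:C ('i * y%:C); rewrite -(complexE (x +i* y)) => /le_trans; apply.
by rewrite cmodM cmod_i mul1r !cmod_real.
Qed.

Lemma cmod_le_eps z : (forall e : R, 0 < e -> cmod z <= e) -> z = 0.
Proof.
move=> h; apply/eqP; rewrite -cmod_eq0 eq_le cmod_ge0 andbT.
by apply/ler_addgt0Pl => e e0; rewrite addr0 h.
Qed.

End Modulus.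

(** * Riemann means over dyadic subdivisions *)

Section DyadicMean.
Variable R : realType.
Implicit Types (f g : R -> R[i]) (a d x y : R) (N : nat).

(* The mean of f over the 2 ^ N points a + j d / 2 ^ N, for j < 2 ^ N. *)
Fixpoint dmean N f a d : R[i] :=
  if N is N'.+1 then (dmean N' f a (d / 2) + dmean N' f (a + d / 2) (d / 2)) / 2
  else f a.

Lemma dmean_eq N f g a d : 0 <= d ->
  (forall x, a <= x <= a + d -> f x = g x) -> dmean N f a d = dmean N g a d.
Proof.
elim: N a d => [|N IH] a d d0 fg /=; first by apply: fg; lra.
by rewrite !IH //; try lra; move=> x hx; apply: fg; lra.
Qed.

Lemma dmean_cst N (c : R[i]) a d : dmean N (fun=> c) a d = c.
Proof. by elim: N a d => [|N IH] a d //=; rewrite !IH; field. Qed.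

Lemma dmeanD N f g a d :
  dmean N (fun x => f x + g x) a d = dmean N f a d + dmean N g a d.
Proof. by elim: N a d => [|N IH] a d //=; rewrite !IH; field. Qed.

Lemma dmeanZ N (c : R[i]) f a d :
  dmean N (fun x => c * f x) a d = c * dmean N f a d.
Proof. by elim: N a d => [|N IH] a d //=; rewrite !IH; field. Qed.

Lemma dmeanB N f g a d :
  dmean N (fun x => f x - g x) a d = dmean N f a d - dmean N g a d.
Proof. by elim: N a d => [|N IH] a d //=; rewrite !IH; field. Qed.

Lemma dmeanJ N f a d :
  dmean N (fun x => (f x)^*) a d = (dmean N f a d)^*.
Proof.
elim: N a d => [|N IH] a d //=; rewrite !IH.
have -> : (2^-1 : R[i]) = (2^-1 : R)%:C by rewrite fmorphV rmorph_nat.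
by rewrite -{1}(conjc_real (2^-1 : R)) -rmorphD -rmorphM.
Qed.

(** The majorant is complex-valued, with only its real part compared, so that its mean can be
    computed by linearity of [dmean]. *)
Lemma dmean_cmod N f g a d : 0 <= d ->
  (forall x, a <= x <= a + d -> cmod (f x) <= complex.Re (g x)) ->
  cmod (dmean N f a d) <= complex.Re (dmean N g a d).
Proof.
elim: N a d => [|N IH] a d d0 fg /=; first by apply: fg; lra.
rewrite cmod_half.
have -> (z : R[i]) : complex.Re (z / 2) = complex.Re z / 2.
  have -> : (2 : R[i]) = (2 : R)%:C by rewrite rmorph_nat.
  by case: z => u v; rewrite -fmorphV /=; field.
rewrite ler_pM2r ?invr_gt0 // (le_trans (cmodD _ _)) // raddfD /= lerD //.
  by apply: IH; [lra|move=> x hx; apply: fg; lra].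
by apply: IH; [lra|move=> x hx; apply: fg; lra].
Qed.

Lemma dmean_bound N f a d (M : R) : 0 <= d ->
  (forall x, a <= x <= a + d -> cmod (f x) <= M) -> cmod (dmean N f a d) <= M.
Proof.
move=> d0 h; have := @dmean_cmod N f (fun=> M%:C) a d d0 h.
by rewrite dmean_cst.
Qed.

End DyadicMean.

(** * Goursat's theorem for Riemann sums on squares *)

Section Goursat.
Variable R : realType.

(** If [P] failed, it would fail on a quarter, then on a quarter of that, and so on. These nested
    squares shrink to a point [(p, q)], where the local hypothesis forbids failure on small
    squares. *)
Lemma bisection (P : R -> R -> R -> Prop) (x0 y0 D : R) : 0 <= D ->
  (forall x y d, P x y (d / 2) -> P (x + d / 2) y (d / 2) ->
     P x (y + d / 2) (d / 2) -> P (x + d / 2) (y + d / 2) (d / 2) ->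
     P x y d) ->
  (forall p q, x0 <= p <= x0 + D -> y0 <= q <= y0 + D ->
     exists2 e, 0 < e & forall x y d, 0 <= d < e ->
       x <= p <= x + d -> y <= q <= y + d -> P x y d) ->
  P x0 y0 D.
Proof.
move=> D0 split local; apply/not_notP => nP.
pose d n : R := D / 2 ^+ n.
have dS n : d n.+1 = d n / 2 by rewrite /d exprS; field; rewrite expf_neq0.
have d_ge0 n : 0 <= d n by rewrite /d divr_ge0 // exprn_ge0.
(* [s] holds the depth and the corner of a square. Failure is assumed under the existential, so that
   [choice] applies to every [s]. *)
have step (s : nat * (R * R)) : exists t : R * R,
    ~ P s.2.1 s.2.2 (d s.1) ->
    [/\ ~ P t.1 t.2 (d s.1.+1),
        s.2.1 <= t.1 /\ t.1 + d s.1.+1 <= s.2.1 + d s.1 &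
        s.2.2 <= t.2 /\ t.2 + d s.1.+1 <= s.2.2 + d s.1].
  case: s => n [x y] /=; have dn := d_ge0 n.
  have [h|h] := pselect (P x y (d n)); first by exists (x, y).
  have [h1|h1] := pselect (P x y (d n / 2)); last first.
    by exists (x, y) => _ /=; rewrite dS; do 2?split; rewrite //; lra.
  have [h2|h2] := pselect (P (x + d n / 2) y (d n / 2)); last first.
    by exists (x + d n / 2, y) => _ /=; rewrite dS; do 2?split; rewrite //; lra.
  have [h3|h3] := pselect (P x (y + d n / 2) (d n / 2)); last first.
    by exists (x, y + d n / 2) => _ /=; rewrite dS; do 2?split; rewrite //; lra.
  exists (x + d n / 2, y + d n / 2) => _ /=; rewrite dS.
  by split; [move=> h4; apply: h; exact: split|split; lra|split; lra].
have [next nextP] := choice step.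
pose u := fix u n := if n is k.+1 then next (k, u k) else (x0, y0).
have uP n : ~ P (u n).1 (u n).2 (d n).
  elim: n => [|n IH] /=; first by rewrite /d expr0 divr1.
  by have [] := nextP (n, u n) IH.
have u1S n : (u n).1 <= (u n.+1).1 /\ (u n.+1).1 + d n.+1 <= (u n).1 + d n.
  by have [] := nextP (n, u n) (uP n).
have u2S n : (u n).2 <= (u n.+1).2 /\ (u n.+1).2 + d n.+1 <= (u n).2 + d n.
  by have [] := nextP (n, u n) (uP n).
(* Nested intervals with left ends [v n] and lengths [d n]: the supremum of the left ends lies in
   all of them. *)
have limit (v : nat -> R) :
    (forall n, v n <= v n.+1 /\ v n.+1 + d n.+1 <= v n + d n) ->
    exists p, forall n, v n <= p <= v n + d n.
  move=> vS.
  have mono n k : v n <= v (n + k)%N /\ v (n + k)%N + d (n + k)%N <= v n + d n.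
    elim: k => [|k [IH1 IH2]]; first by rewrite addn0; split.
    by rewrite addnS; have [h1 h2] := vS (n + k)%N; split; lra.
  have ub n m : v m <= v n + d n.
    have [nm|mn] := leqP n m.
      have [_] := mono n (m - n)%N; rewrite subnKC // => h.
      by have := d_ge0 m; lra.
    have [h _] := mono m (n - m)%N; rewrite subnKC in h; last exact: ltnW.
    by have := d_ge0 n; lra.
  have vub n : ubound (range v) (v n + d n) by move=> _ [m _ <-]; exact: ub.
  exists (sup (range v)) => n; apply/andP; split.
    by apply: ub_le_sup; [exists (v 0%N + d 0%N); exact: vub|exists n].
  by apply: ge_sup; [exists (v 0%N); exists 0%N|exact: vub].
have [p pP] := limit (fun n => (u n).1) u1S.
have [q qP] := limit (fun n => (u n).2) u2S.
have d00 : d 0%N = D by rewrite /d expr0 divr1.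
have px : x0 <= p <= x0 + D by have := pP 0%N; rewrite d00.
have qy : y0 <= q <= y0 + D by have := qP 0%N; rewrite d00.
have [e e0 he] := local p q px qy.
(* As [n < 2 ^ n], any [n] above [D / e] will do. *)
have [n dn] : exists n, d n < e.
  have [n hn] : exists n : nat, D / e < n%:R.
    by exists (Num.trunc (D / e)).+1; rewrite truncnS_gt.
  exists n; rewrite /d ltr_pdivrMr ?exprn_gt0 //.
  rewrite ltr_pdivrMr // mulrC in hn; apply: lt_le_trans hn _.
  rewrite ler_pM2l // -natrX ler_nat; exact/ltnW/ltn_expl.
by apply: (uP n); apply: he; rewrite ?d_ge0.
Qed.

(* The Riemann sum, with 2 ^ N nodes per side, of the integral of G along the
   boundary of the square with lower left corner (x, y) and side d. *)
Definition contour (G : R -> R -> R[i]) N (x y d : R) : R[i] :=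
  d%:C * (dmean N (G^~ y) x d - dmean N (G^~ (y + d)) x d
          + 'i * (dmean N (G (x + d)) y d - dmean N (G x) y d)).

(** Each inner side occurs in two quarters with opposite signs and the same [2 ^ N] nodes, so the
    cancellation is exact. *)
Lemma contourS G N x y d : contour G N.+1 x y d =
  contour G N x y (d / 2) + contour G N (x + d / 2) y (d / 2) +
  contour G N x (y + d / 2) (d / 2) +
  contour G N (x + d / 2) (y + d / 2) (d / 2).
Proof.
have half u : u + d / 2 + d / 2 = u + d by field.
rewrite /contour /= !half.
have -> : (d / 2)%:C = d%:C / 2 by rewrite rmorphM fmorphV rmorph_nat.
by field.
Qed.

(** Constants have zero contour sum, so [p] may be subtracted; each of the four sides then
    contributes at most [d * M]. *)
Lemma contour_bound G N x y d (p : R[i]) (M : R) : 0 <= d ->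
  (forall s t, x <= s <= x + d -> y <= t <= y + d -> cmod (G s t - p) <= M) ->
  cmod (contour G N x y d) <= 4 * d * M.
Proof.
move=> d0 h.
have -> : contour G N x y d = contour (fun s t => G s t - p) N x y d.
  by rewrite /contour !dmeanB !dmean_cst; congr (_ * _); ring.
rewrite /contour cmodM cmod_real ger0_norm // (mulrC 4) -mulrA ler_wpM2l //.
have b1 : cmod (dmean N (fun s => G s y - p) x d) <= M.
  by apply: dmean_bound => // s hs; apply: h => //; lra.
have b2 : cmod (dmean N (fun s => G s (y + d) - p) x d) <= M.
  by apply: dmean_bound => // s hs; apply: h => //; lra.
have b3 : cmod (dmean N (fun t => G x t - p) y d) <= M.
  by apply: dmean_bound => // s hs; apply: h => //; lra.
have b4 : cmod (dmean N (fun t => G (x + d) t - p) y d) <= M.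
  by apply: dmean_bound => // s hs; apply: h => //; lra.
apply: le_trans (cmodD _ _) _; rewrite cmodM cmod_i mul1r.
have := cmodD (dmean N (fun s => G s y - p) x d)
              (- dmean N (fun s => G s (y + d) - p) x d).
have := cmodD (dmean N (fun t => G (x + d) t - p) y d)
              (- dmean N (fun t => G x t - p) y d).
rewrite !cmodN; lra.
Qed.

(** The means of [s + i t] over opposite sides differ by [i d] and by [d], and the two differences
    cancel in the contour sum at every [N], with no passage to the limit. *)
Lemma contour_affine G N x y d (B : R[i]) :
  contour (fun s t => G s t - B * (s +i* t)) N x y d = contour G N x y d.
Proof.
rewrite /contour !dmeanB !dmeanZ.
have E1 : dmean N (fun t => t +i* (y + d)) x d =
    dmean N (fun t => t +i* y) x d + 'i * d%:C.
  have -> : 'i * d%:C = dmean N (fun=> 'i * d%:C) x d by rewrite dmean_cst.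
  rewrite -dmeanD; congr dmean.
  by apply/funext => t; simpc.
have E2 : dmean N (fun t => (x + d) +i* t) y d =
    dmean N (fun t => x +i* t) y d + d%:C.
  have -> : d%:C = dmean N (fun=> d%:C) y d by rewrite dmean_cst.
  rewrite -dmeanD; congr dmean.
  by apply/funext => t; simpc.
by rewrite E1 E2; ring.
Qed.

(** Complex differentiability in [s + i t]: a single complex [B] acts on both increments. The size
    of the increment is measured by the sum of the coordinates. *)
Definition plane_diff (G : R -> R -> R[i]) p q := exists B : R[i],
  forall e : R, 0 < e -> exists2 r, 0 < r & forall s t,
    `|s - p| < r -> `|t - q| < r ->
    cmod (G s t - G p q - B * ((s - p) +i* (t - q))) <= e * (`|s - p| + `|t - q|).

Definition plane_cont (G : R -> R -> R[i]) p q :=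
  forall e : R, 0 < e -> exists2 r, 0 < r & forall s t,
    `|s - p| < r -> `|t - q| < r -> cmod (G s t - G p q) <= e.

(** The signed square root of [s - p], because [Num.sqrt] is 0 on negative numbers. *)
Let sqrt_diff p s : R := Num.sqrt (s - p) - Num.sqrt (p - s).

(** Bisection is applied to the bound of the sum by [c * nu], where [nu] is additive under
    quadrisection. Near a point of differentiability the affine part drops out and the rest is of
    order [d ^+ 2]; near [(a, b)] continuity gives order [d]. *)
Lemma goursat (G : R -> R -> R[i]) (a b x0 y0 D e : R) : 0 <= D -> 0 < e ->
  (forall p q, x0 <= p <= x0 + D -> y0 <= q <= y0 + D ->
     plane_diff G p q \/ [/\ p = a, q = b & plane_cont G p q]) ->
  exists N0, forall N, (N0 <= N)%N -> cmod (contour G N x0 y0 D) <= e.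
Proof.
move=> D0 e0 hG.
(* The second term of the weight is additive like the area, but only of order
   d at (a, b), which is what continuity alone can beat. *)
pose nu x y d := d ^+ 2 +
  (sqrt_diff a (x + d) - sqrt_diff a x) * (sqrt_diff b (y + d) - sqrt_diff b y).
have rmono p x d : 0 <= d -> sqrt_diff p x <= sqrt_diff p (x + d).
  by move=> d0; rewrite /sqrt_diff lerB // ler_wsqrtr //; lra.
have nu_ge x y d : 0 <= d -> d ^+ 2 <= nu x y d.
  by move=> d0; rewrite /nu lerDl mulr_ge0 // subr_ge0 rmono.
have nu0 : 0 <= nu x0 y0 D by apply: le_trans (nu_ge _ _ _ D0); exact: sqr_ge0.
(* Chosen so that [c * nu x0 y0 D <= e]; the 1 keeps the denominator positive when [nu] vanishes. *)
pose c := e / (nu x0 y0 D + 1).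
have c0 : 0 < c by rewrite divr_gt0 //; lra.
suff [N0 hN] : exists N0, forall N, (N0 <= N)%N ->
    cmod (contour G N x0 y0 D) <= c * nu x0 y0 D.
  exists N0 => N /hN /le_trans; apply.
  by rewrite /c mulrAC ler_pdivrMr ?ler_pM2l //; lra.
apply: (bisection (P := fun x y d => exists N0, forall N, (N0 <= N)%N ->
    cmod (contour G N x y d) <= c * nu x y d)) => //.
- move=> x y d [N1 h1] [N2 h2] [N3 h3] [N4 h4].
  (* The successor is due to [contourS], which passes from level [N.+1] to level [N] on the
     quarters. *)
  exists (N1 + N2 + N3 + N4).+1 => -[//|N] hN; rewrite contourS.
  have {}h1 := h1 N ltac:(lia); have {}h2 := h2 N ltac:(lia).
  have {}h3 := h3 N ltac:(lia); have {}h4 := h4 N ltac:(lia).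
  have half u : u + d / 2 + d / 2 = u + d by field.
  have -> : nu x y d = nu x y (d / 2) + nu (x + d / 2) y (d / 2) +
     nu x (y + d / 2) (d / 2) + nu (x + d / 2) (y + d / 2) (d / 2).
    by rewrite /nu !half; field.
  apply: le_trans (cmodD _ _) _; rewrite mulrDr lerD //.
  apply: le_trans (cmodD _ _) _; rewrite mulrDr lerD //.
  by apply: le_trans (cmodD _ _) _; rewrite mulrDr lerD.
- move=> p q hp hq; have [[B hB]|[pa qb hc]] := hG p q hp hq.
  (* The increment is at most [2 * d] and [contour_bound] has the factor [4 * d], whose product with
     [c / 8] is [c * d ^+ 2]. *)
  + have [r r0 hr] := hB (c / 8) ltac:(lra).
    exists r => // x y d /andP[d0 dr] xp yq; exists 0%N => N _.
    have small s : x <= s <= x + d -> `|s - p| <= d by move=> hs; rewrite ler_norml; lra.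
    have small' t : y <= t <= y + d -> `|t - q| <= d by move=> ht; rewrite ler_norml; lra.
    apply: le_trans (ler_wpM2l (ltW c0) (nu_ge x y d d0)).
    rewrite -(contour_affine _ _ _ _ _ B).
    apply: le_trans
      (contour_bound (p := G p q - B * (p +i* q)) (M := c / 4 * d) _ d0 _) _.
      move=> s t hs ht.
      have -> : G s t - B * (s +i* t) - (G p q - B * (p +i* q)) =
        G s t - G p q - B * ((s - p) +i* (t - q)).
        have -> : (s - p) +i* (t - q) = (s +i* t) - (p +i* q) by simpc.
        ring.
      have := small _ hs; have := small' _ ht => h1 h2.
      apply: le_trans (hr s t (le_lt_trans h2 dr) (le_lt_trans h1 dr)) _.
      have -> : c / 4 * d = c / 8 * (d + d) by field.
      by apply: ler_wpM2l; [lra|exact: lerD].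
    by rewrite expr2; lra.
  + have [r r0 hr] := hc (c / 4) ltac:(lra).
    exists r => // x y d /andP[d0 dr] xp yq; exists 0%N => N _.
    apply: le_trans (contour_bound (p := G p q) (M := c / 4) _ d0 _) _.
      move=> s t hs ht.
      have h1 : `|s - p| <= d by rewrite ler_norml; lra.
      have h2 : `|t - q| <= d by rewrite ler_norml; lra.
      by apply: hr; lra.
    (* The increment is a sum of two square roots whose arguments add up to [d], and the square root
       is subadditive. *)
    have sqrt_diff_ge u v : u <= v <= u + d ->
        Num.sqrt d <= sqrt_diff v (u + d) - sqrt_diff v u.
      move=> huv; rewrite /sqrt_diff.
      rewrite (@ler0_sqrtr _ (v - (u + d))); last lra.
      rewrite (@ler0_sqrtr _ (u - v)); last lra.
      rewrite subr0 sub0r opprK.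
      rewrite -ler_sqr ?nnegrE ?addr_ge0 ?sqrtr_ge0 // sqrrD !sqr_sqrtr; try lra.
      by have := mulr_ge0 (sqrtr_ge0 (u + d - v)) (sqrtr_ge0 (v - u)); lra.
    have : d <= nu x y d.
      rewrite /nu -pa -qb; apply: (@le_trans _ _ (Num.sqrt d * Num.sqrt d)).
        by rewrite -expr2 sqr_sqrtr.
      rewrite -[X in X <= _]add0r lerD ?sqr_ge0 // ler_pM ?sqrtr_ge0 ?sqrt_diff_ge //.
    by move=> h; have := ler_wpM2l (ltW c0) h; lra.
Qed.

End Goursat.

(** * Frechet differentiability in epsilon-delta form *)

Section LittleO.
Context {K : numFieldType} {V W : normedModType K}.
Implicit Types (f : V -> W) (x : V).

Lemma differentiable_le f x : differentiable f x ->
  forall e : K, 0 < e -> exists2 r : K, 0 < r &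
    forall y, `|y - x| < r -> `|f y - f x - 'd f x (y - x)| <= e * `|y - x|.
Proof.
move=> /diff_locallyP[_ /eqaddoP h] e e0.
have /nbhs_norm0P[r r0 hr] := h e e0.
exists r => // y yr; have := hr (y - x) yr.
by rewrite /= !fctE /= subrK opprD addrA.
Qed.

Lemma le_differentiable f x (L : {linear V -> W}) : continuous L ->
  (forall e : K, 0 < e -> exists2 r : K, 0 < r &
    forall y, `|y - x| < r -> `|f y - f x - L (y - x)| <= e * `|y - x|) ->
  differentiable f x.
Proof.
move=> cL h.
have E : f \o shift x = cst (f x) + L +o_ 0 id.
  apply/eqaddoP => e e0; have [r r0 hr] := h e e0.
  apply/nbhs_norm0P; exists r => // y yr /=.
  have := hr (y + x); rewrite addrK => /(_ yr).
  by rewrite !fctE /= opprD addrA.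
have dL := diff_unique cL E.
by apply/diff_locallyP; rewrite dL.
Qed.

End LittleO.

(** * Complex differentiability and continuity with real radii *)

Section ComplexDiff.
Variable R : realType.
Implicit Types (g : R[i] -> R[i]) (t u : R[i]) (e r : R).

Definition cdiff g t := exists B : R[i], forall e, 0 < e ->
  exists2 r, 0 < r & forall u, cmod (u - t) < r ->
    cmod (g u - g t - B * (u - t)) <= e * cmod (u - t).

Definition ccont g t := forall e, 0 < e ->
  exists2 r, 0 < r & forall u, cmod (u - t) < r -> cmod (g u - g t) <= e.

Lemma cplx_norm (x : cplx R) : `|x| = (cmod x)%:C.
Proof. by []. Qed.

(** A positive element of [R[i]] has zero imaginary part. This turns radii taken in the field [R[i]]
    into real ones. *)
Lemma cplx_gt0 (x : cplx R) : 0 < x -> exists2 r : R, 0 < r & x = r%:C.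
Proof.
case: x => a b; rewrite -[0 < _]/(0 < a +i* b) ltcE /= => /andP[/eqP -> a0].
by exists a.
Qed.

Lemma cplx_ltr (x y : R) : ((x%:C : cplx R) < y%:C) = (x < y).
Proof. exact: ltcR. Qed.

Lemma cplx_ler (x y : R) : ((x%:C : cplx R) <= y%:C) = (x <= y).
Proof. exact: lecR. Qed.

(** The differential is linear over [R[i]], hence is multiplication by its value at 1. *)
Lemma differentiable_cdiff (g : cplx R -> cplx R) (t : cplx R) :
  differentiable g t -> cdiff g t.
Proof.
move=> dg; exists ('d g t 1) => e e0.
have [|_ /cplx_gt0[r r0 ->] hr] := differentiable_le dg (e := e%:C).
  by rewrite cplx_ltr.
exists r => // u ur; have := hr u; rewrite !cplx_norm cplx_ltr => /(_ ur).
rewrite [X in _ <= X -> _](_ : _ = (e * cmod (u - t))%:C); last by rewrite rmorphM.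
rewrite cplx_ler.
have {1}-> : u - t = (u - t : cplx R) *: (1 : cplx R) by rewrite /GRing.scale /= mulr1.
by rewrite linearZ /= [_ * _ in X in _ -> X]mulrC.
Qed.

Lemma cdiff_ccont g t : cdiff g t -> ccont g t.
Proof.
move=> [B hB] e e0; have [r r0 hr] := hB 1 ltr01.
have B0 := cmod_ge0 B.
exists (Num.min r (e / (1 + cmod B))); first by rewrite lt_min r0 divr_gt0 //; lra.
move=> u; rewrite lt_min ltr_pdivlMr; last lra.
move=> /andP[ur ue]; have h := hr u ur.
have -> : g u - g t = (g u - g t - B * (u - t)) + B * (u - t) by ring.
apply: le_trans (cmodD _ _) _; rewrite cmodM; nra.
Qed.

End ComplexDiff.

(** * The complex exponential in real coordinates *)

Section PlaneExp.
Variable R : realType.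
Implicit Types s t p q e : R.

Definition cis t : R[i] := cos t +i* sin t.

(** The exponential of [s + i t], curried in the form that [goursat] takes; vertical segments of
    length [2 * pi] go to circles. *)
Definition cexp s t : R[i] := (expR s)%:C * cis t.

Lemma cmod_cis t : cmod (cis t) = 1.
Proof. by rewrite cmodE /= cos2Dsin2 sqrtr1. Qed.

Lemma cmod_cexp s t : cmod (cexp s t) = expR s.
Proof. by rewrite cmodM cmod_cis mulr1 cmod_real gtr0_norm ?expR_gt0. Qed.

Lemma cexpD s t p q : cexp (s + p) (t + q) = cexp s t * cexp p q.
Proof.
by rewrite /cexp /cis expRD sinD cosD; simpc; congr (_ +i* _); ring.
Qed.

Lemma is_derive_le (f : R -> R) (x df : R) : is_derive x 1 f df ->
  forall e, 0 < e -> exists2 r, 0 < r & forall y,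
    `|y - x| < r -> `|f y - f x - df * (y - x)| <= e * `|y - x|.
Proof.
move=> [/derivable1_diffP dx fdf] e e0.
have [r r0 hr] := differentiable_le dx e0.
exists r => // y /hr; rewrite deriv1E; last exact/derivable1_diffP.
by rewrite derive1E fdf /GRing.scale /= [_ * df]mulrC.
Qed.

Lemma cexp_diff0 e : 0 < e -> exists2 r, 0 < r & forall s t,
  `|s| < r -> `|t| < r -> cmod (cexp s t - 1 - s +i* t) <= e * (`|s| + `|t|).
Proof.
move=> e0.
(* The error terms below add up to at most [e' * |s| + 7 * e' * |t|]. The product of [expR s - 1]
   and [sin t] is among them, thanks to [|s| < e']. *)
have [e' [e'0 e'1 e'e]] : exists e', [/\ 0 < e', e' <= 1 & e' <= e / 8].
  exists (Num.min 1 (e / 8)); rewrite lt_min ltr01 !ge_min !lexx orbT.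
  by split=> //; lra.
have [r1 r10 h1] := is_derive_le (is_derive_expR 0) e'0.
have [r2 r20 h2] := is_derive_le (is_derive_cos 0) e'0.
have [r3 r30 h3] := is_derive_le (is_derive_sin 0) e'0.
exists (Num.min e' (Num.min r1 (Num.min r2 r3))); first by rewrite !lt_min e'0 r10 r20.
move=> s t; rewrite !lt_min => /and4P[se s1 s2 s3] /and4P[te t1 t2 t3].
have {h1} := h1 s; rewrite subr0 expR0 mul1r => /(_ s1) h1.
have {h2} := h2 t; rewrite subr0 cos0 sin0 oppr0 mul0r subr0 => /(_ t2) h2.
have {h3} := h3 t; rewrite subr0 sin0 cos0 subr0 mul1r => /(_ t3) h3.
have -> : cexp s t - 1 - s +i* t =
    ((expR s - 1 - s) * cos t + (1 + s) * (cos t - 1)) +i*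
    ((expR s - 1) * sin t + (sin t - t)).
  by rewrite /cexp /cis; simpc; congr (_ +i* _); ring.
have S0 := normr_ge0 s; have T0 := normr_ge0 t.
have b1 : `|(expR s - 1 - s) * cos t| <= e' * `|s|.
  by rewrite normrM -[leRHS]mulr1 ler_pM // cos_max.
have b2 : `|(1 + s) * (cos t - 1)| <= 2 * (e' * `|t|).
  rewrite normrM ler_pM //.
  by have := ler_normD 1 s; rewrite normr1; lra.
have b3 : `|(expR s - 1) * sin t| <= e' * `|t| * 4.
  have a1 : `|expR s - 1| <= 2 * `|s|.
    have -> : expR s - 1 = (expR s - 1 - s) + s by ring.
    by apply: le_trans (ler_normD _ _) _; nra.
  have a2 : `|sin t| <= 2 * `|t|.
    have -> : sin t = (sin t - t) + t by ring.
    by apply: le_trans (ler_normD _ _) _; nra.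
  rewrite normrM; apply: (@le_trans _ _ ((2 * `|s|) * (2 * `|t|))).
    by rewrite ler_pM.
  by nra.
apply: le_trans (cmod_Complex _ _) _.
have := ler_normD ((expR s - 1 - s) * cos t) ((1 + s) * (cos t - 1)).
have := ler_normD ((expR s - 1) * sin t) (sin t - t).
nra.
Qed.

(** The functional equation [cexpD] moves the expansion at 0 to [(p, q)]. *)
Lemma plane_diff_cexp p q : plane_diff cexp p q.
Proof.
exists (cexp p q) => e e0.
have E0 : 0 < expR p by exact: expR_gt0.
have [r r0 hr] := cexp_diff0 (e := e / expR p) ltac:(by rewrite divr_gt0).
exists r => // s t sr tr.
have -> : cexp s t = cexp p q * cexp (s - p) (t - q).
  by rewrite -cexpD; congr cexp; ring.
have -> : cexp p q * cexp (s - p) (t - q) - cexp p q -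
    cexp p q * ((s - p) +i* (t - q)) =
  cexp p q * (cexp (s - p) (t - q) - 1 - (s - p) +i* (t - q)) by ring.
rewrite cmodM cmod_cexp; have := hr _ _ sr tr.
by rewrite mulrAC ler_pdivlMr // mulrC.
Qed.

Lemma plane_cont_cexp p q : plane_cont cexp p q.
Proof.
have [B hB] := plane_diff_cexp p q; move=> e e0.
have [r r0 hr] := hB 1 ltr01; have B0 := cmod_ge0 B.
exists (Num.min r (e / (2 * (1 + cmod B)))).
  by rewrite lt_min r0 divr_gt0 //; lra.
move=> s t; rewrite !lt_min !ltr_pdivlMr; try lra.
move=> /andP[sr se] /andP[tr te].
have h := hr s t sr tr; have h2 := cmod_Complex (s - p) (t - q).
have -> : cexp s t - cexp p q = (cexp s t - cexp p q - B * ((s - p) +i* (t - q)))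
   + B * ((s - p) +i* (t - q)) by ring.
apply: le_trans (cmodD _ _) _; rewrite cmodM; nra.
Qed.

Lemma plane_cont_comp (g : R[i] -> R[i]) p q : ccont g (cexp p q) ->
  plane_cont (fun s t => g (cexp s t)) p q.
Proof.
move=> hg e e0; have [r r0 hr] := hg e e0.
have [r' r'0 hr'] := plane_cont_cexp p q (e := r / 2) ltac:(lra).
by exists r' => // s t sr tr; apply: hr; have := hr' s t sr tr; lra.
Qed.

Lemma plane_diff_comp (g : R[i] -> R[i]) p q : cdiff g (cexp p q) ->
  plane_diff (fun s t => g (cexp s t)) p q.
Proof.
move=> [B hB]; have [E hE] := plane_diff_cexp p q.
exists (B * E) => e e0.
have B0 := cmod_ge0 B; have E0 := cmod_ge0 E.
(* The remainder of [g] and that of [cexp] get half of [e] each: the first is multiplied by at most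
   [1 + cmod E], the second by [cmod B]. *)
pose e1 := e / (2 * (1 + cmod E)).
have e10 : 0 < e1 by rewrite divr_gt0 //; lra.
have [r1 r10 h1] := hB e1 e10.
pose e2 := Num.min 1 (e / (2 * (1 + cmod B))).
have e20 : 0 < e2 by rewrite lt_min ltr01 divr_gt0 //; lra.
have [r2 r20 h2] := hE e2 e20.
have [r3 r30 h3] := plane_cont_cexp p q (e := r1 / 2) ltac:(lra).
exists (Num.min r2 r3); first by rewrite lt_min r20.
move=> s t; rewrite !lt_min => /andP[s2 s3] /andP[t2 t3].
have {}h3 : cmod (cexp s t - cexp p q) < r1 by have := h3 s t s3 t3; lra.
have {}h1 := h1 _ h3; have {}h2 := h2 _ _ s2 t2.
set h := (s - p) +i* (t - q) in h2 *.
set d := cexp s t - cexp p q in h1 h2 *.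
have hh : cmod h <= `|s - p| + `|t - q| by exact: cmod_Complex.
set w := `|s - p| + `|t - q| in h2 hh *.
have w0 : 0 <= w by apply: le_trans hh; exact: cmod_ge0.
have -> : g (cexp s t) - g (cexp p q) - B * E * h =
  (g (cexp s t) - g (cexp p q) - B * d) + B * (d - E * h) by ring.
apply: le_trans (cmodD _ _) _; rewrite cmodM.
have [e21 e2e] : e2 <= 1 /\ e2 <= e / (2 * (1 + cmod B)).
  by split; rewrite ge_min lexx ?orbT.
have hd : cmod d <= (1 + cmod E) * w.
  have -> : d = (d - E * h) + E * h by ring.
  apply: le_trans (cmodD _ _) _; rewrite cmodM; nra.
have a1 : e1 * cmod d <= e / 2 * w.
  have -> : e / 2 * w = e1 * ((1 + cmod E) * w) by rewrite /e1; field; lra.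
  by rewrite ler_wpM2l // ltW.
have a2 : cmod B * cmod (d - E * h) <= e / 2 * w.
  have -> : e / 2 * w = (1 + cmod B) * (e / (2 * (1 + cmod B)) * w).
    by field; lra.
  apply: ler_pM => //; rewrite ?cmod_ge0 //; first lra.
  by apply: le_trans h2 _; rewrite ler_wpM2r.
lra.
Qed.

End PlaneExp.

(** * Limits of complex sequences *)

Section Tends.
Variable R : realType.
Implicit Types (u v : nat -> R[i]) (l k c : R[i]).

Definition tends u l := forall e : R, 0 < e ->
  exists N0, forall N, (N0 <= N)%N -> cmod (u N - l) <= e.

Lemma tends_ext u v l : (forall N, u N = v N) -> tends u l -> tends v l.
Proof. by move=> /funext->. Qed.

Lemma tends_cst c : tends (fun=> c) c.
Proof. by move=> e e0; exists 0%N => N _; rewrite subrr cmod0 ltW. Qed.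

Lemma tendsD u v l k : tends u l -> tends v k -> tends (fun N => u N + v N) (l + k).
Proof.
move=> hu hv e e0.
have [N1 h1] := hu (e / 2) ltac:(lra); have [N2 h2] := hv (e / 2) ltac:(lra).
exists (N1 + N2)%N => N hN; rewrite opprD addrACA.
have {}h1 := h1 N ltac:(lia); have {}h2 := h2 N ltac:(lia).
by apply: le_trans (cmodD _ _) _; lra.
Qed.

Lemma tendsZ c u l : tends u l -> tends (fun N => c * u N) (c * l).
Proof.
move=> hu e e0; have c0 := cmod_ge0 c.
have [N0 h0] := hu (e / (1 + cmod c)) ltac:(by rewrite divr_gt0 //; lra).
exists N0 => N /h0; rewrite -mulrBr cmodM ler_pdivlMr; last lra.
by have := cmod_ge0 (u N - l); nra.
Qed.

Lemma tendsB u v l k : tends u l -> tends v k -> tends (fun N => u N - v N) (l - k).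
Proof.
move=> hu /(tendsZ (-1)) hv; rewrite -[- k]mulN1r.
by apply: tends_ext (tendsD hu hv) => N; rewrite mulN1r.
Qed.

Lemma tendsJ u l : tends u l -> tends (fun N => (u N)^*) l^*.
Proof.
move=> hu e /hu[N0 h0]; exists N0 => N /h0.
by rewrite -rmorphB; case: (u N - l) => x y; rewrite !cmodE /= sqrrN.
Qed.

Lemma tends_bound u l (M : R) : tends u l -> (forall N, cmod (u N) <= M) ->
  cmod l <= M.
Proof.
move=> hu hM; apply/ler_addgt0Pr => e /hu[N0 /(_ N0 (leqnn _))].
have := hM N0; have := cmodD (u N0) (- (u N0 - l)).
by rewrite cmodN opprB addrC subrK; lra.
Qed.

End Tends.

(** * The mean value property on circles *)

Section MeanValue.
Variable R : realType.
Implicit Types (q g h : R[i] -> R[i]) (t : R[i]) (r rho a s : R) (N : nat).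

(** The angles start at [- pi], so that a point of the positive real axis is met only at angle 0 and
    not at both ends of the range. *)
Definition circ N q r := dmean N (fun th => q (r%:C * cis th)) (- pi) (2 * pi).

(** [goursat] is applied to [q (cexp x y)] on a square of side [2 * pi]. The horizontal sides cancel
    by periodicity; the vertical ones are the means over two circles. The exceptional point becomes
    [(ln a, 0)]. *)
Lemma circ_step q rho a s : 0 < a -> expR s < rho ->
  (forall t, t != 0 -> cmod t < rho -> cdiff q t \/ (t = a%:C /\ ccont q t)) ->
  tends (fun N => circ N q (expR s) - circ N q (expR (s - 2 * pi))) 0.
Proof.
move=> a0 srho hq.
have pi0 : 0 < pi :> R by exact: pi_gt0.
have := @goursat R (fun x y : R => q (cexp x y)) (ln a) 0 (s - 2 * pi) (- pi) (2 * pi).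
move=> gour e e0.
have {}gour := gour (2 * pi * e) ltac:(lra) ltac:(nra).
have [|N0 hN0] := gour.
  move=> p th hp hth.
  have c0 : cexp p th != 0 by rewrite -cmod_gt0 cmod_cexp expR_gt0.
  have crho : cmod (cexp p th) < rho.
    by rewrite cmod_cexp; apply: le_lt_trans srho; rewrite ler_expR; lra.
  have [d|[E c]] := hq _ c0 crho; first by left; exact: plane_diff_comp.
  right; split; last exact: plane_cont_comp.
    by rewrite -(expRK p) -(cmod_cexp p th) E cmod_real gtr0_norm.
  have Ep : expR p = a by rewrite -(cmod_cexp p th) E cmod_real gtr0_norm.
  have cos1 : cos th = 1.
    move: E; rewrite /cexp /cis Ep; simpc => -[E _].
    by apply: (mulfI (lt0r_neq0 a0)); rewrite mulr1.
  (* [cos] is injective on [[0, pi]], hence the passage from [th] to its absolute value. *)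
  apply/eqP; rewrite -normr_eq0; apply/eqP; apply: (@cos_inj R).
  - by rewrite in_itv /= normr_ge0 ler_norml; lra.
  - by rewrite in_itv /= lexx pi_ge0.
  by rewrite cos0; case: (ger0P th) => _; rewrite ?cosN.
exists N0 => N /hN0; rewrite subr0.
rewrite /contour.
have -> : s - 2 * pi + 2 * pi = s by ring.
have -> : (fun s => q (cexp s (- pi + 2 * pi))) = (fun s => q (cexp s (- pi))).
  apply/funext => u; congr (q (_ * _)); rewrite /cis cosN sinN.
  have -> : - pi + 2 * pi = pi :> R by ring.
  by rewrite sinpi oppr0.
rewrite subrr add0r !cmodM cmod_real gtr0_norm; last lra.
by rewrite cmod_i mul1r ler_pM2l //; lra.
Qed.

(** Finitely many applications of [circ_step] shrink the circle until continuity at 0 puts all its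
    values near [q 0]. The number [k] of steps is fixed before [N] grows. *)
Lemma mean_value q rho a r : 0 < a -> 0 < r < rho -> ccont q 0 ->
  (forall t, t != 0 -> cmod t < rho -> cdiff q t \/ (t = a%:C /\ ccont q t)) ->
  tends (fun N => circ N q r) (q 0).
Proof.
move=> a0 /andP[r0 rrho] q0 hq.
have pi0 : 0 < pi :> R by exact: pi_gt0.
have steps k : tends (fun N => circ N q r - circ N q (expR (ln r - 2 * pi * k%:R))) 0.
  elim: k => [|k IH].
    apply: tends_ext (tends_cst 0) => N.
    by rewrite mulr0 subr0 lnK // subrr.
  rewrite -[X in tends _ X](addr0 0).
  have lt : expR (ln r - 2 * pi * k%:R) < rho.
    apply: le_lt_trans rrho; rewrite -[leRHS](@lnK _ r) // ler_expR gerBl.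
    by rewrite !mulr_ge0 // ltW.
  apply: tends_ext (tendsD IH (circ_step a0 lt hq)) => N.
  rewrite addrA subrK; congr (_ - circ _ _ (expR _)).
  by rewrite -natr1; ring.
move=> e e0; have [d d0 hd] := q0 (e / 2) ltac:(lra).
(* It suffices that [k] exceeds [r / d], since [expR (2 * pi * k)] exceeds [k]. *)
have [k hk] : exists k : nat, expR (ln r - 2 * pi * k%:R) < d.
  exists (Num.trunc (r / d)).+1.
  have : r / d < (Num.trunc (r / d)).+1%:R by rewrite truncnS_gt.
  move: (Num.trunc (r / d)).+1 => k kr.
  have k0 : 0 < k%:R :> R by apply: lt_trans kr; rewrite divr_gt0.
  have : k%:R < expR (2 * pi * k%:R) :> R.
    have := expR_ge1Dx (2 * pi * k%:R : R).
    have : 1 < pi :> R by have := pi_ge2 R; lra.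
    by nra.
  rewrite expRB lnK // ltr_pdivrMr ?expR_gt0 // => h.
  by rewrite ltr_pdivrMr // mulrC in kr; nra.
have [N0 hN] := steps k (e / 2) ltac:(lra).
exists N0 => N /hN; rewrite subr0; set u := circ N q (expR _) => h1.
have h2 : cmod (u - q 0) <= e / 2.
  rewrite /u /circ -(dmean_cst N (q 0) (- pi) (2 * pi)) -dmeanB.
  apply: dmean_bound => [|th _]; first lra.
  by apply: hd; rewrite subr0 cmod_cexp.
have -> : circ N q r - q 0 = (circ N q r - u) + (u - q 0) by ring.
by apply: le_trans (cmodD _ _) _; lra.
Qed.

End MeanValue.

(** * The mean value property for differentiable functions *)

Section Cauchy.
Variable R : realType.
Variables (g : R[i] -> R[i]) (rho : R).
Hypothesis dg : forall t : cplx R, cmod t < rho ->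
  differentiable (g : cplx R -> cplx R) t.
Implicit Types (t : R[i]) (r a : R) (N : nat).

Lemma mean_value_differentiable r : 0 < r < rho -> tends (fun N => circ N g r) (g 0).
Proof.
move=> hr; apply: (@mean_value _ _ rho 1) => //.
  apply/cdiff_ccont/differentiable_cdiff/dg.
  by case/andP: hr => r0 /(lt_trans r0); rewrite cmod0.
by move=> t _ ht; left; apply/differentiable_cdiff/dg.
Qed.

End Cauchy.

(** * Cauchy's formula at a point of the positive real axis *)

Section CauchyFormula.
Variable R : realType.
Variables (g : R[i] -> R[i]) (rho : R).
Hypothesis dg : forall t : cplx R, cmod t < rho ->
  differentiable (g : cplx R -> cplx R) t.
Implicit Types (t : R[i]) (r a : R) (N : nat).

(** On the circle [t * t^*] is [r ^+ 2], so the kernel is the conjugate of [k], which is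
    differentiable on a larger disc and equals 1 at 0. The mean value property of [k] gives the
    limit. *)
Lemma kernel_mean r a : 0 < a < r ->
  tends (fun N => circ N (fun t => t / (t - a%:C)) r) 1.
Proof.
move=> /andP[a0 ar]; have r0 : 0 < r by lra.
pose k (t : cplx R) : cplx R := (r ^+ 2)%:C / ((r ^+ 2)%:C - a%:C * t).
have dk (t : cplx R) : cmod t < r ^+ 2 / a -> differentiable k t.
  rewrite (ltr_pdivlMr _ _ a0) => ht.
  apply: differentiableM; first exact: differentiable_cst.
  apply: differentiableV.
    apply: differentiableB; first exact: differentiable_cst.
    by apply: differentiableM; [exact: differentiable_cst|exact: ex_diff].
  rewrite subr_eq0; apply/eqP => E.
  have : cmod ((r ^+ 2)%:C : R[i]) = cmod (a%:C * t : R[i]) by rewrite E.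
  rewrite cmodM !cmod_real ger0_norm ?sqr_ge0 // gtr0_norm //; lra.
have rr : 0 < r < r ^+ 2 / a by rewrite r0 ltr_pdivlMr //= expr2 ltr_pM2l.
have := tendsJ (mean_value_differentiable dk rr).
have -> : k 0 = 1 :> R[i].
  rewrite /k mulr0 subr0 divff //.
  by rewrite -[0]/((0 : R)%:C) (inj_eq (@complexI R)) expf_neq0 // gt_eqF.
rewrite conjc1; apply: tends_ext => N.
rewrite /circ -dmeanJ; apply: dmean_eq => [|th _].
  by rewrite mulr_ge0 // pi_ge0.
set t := _ * _.
have tr : t * t^* = (r ^+ 2)%:C.
  rewrite /t /cis; simpc; congr (_ +i* _); last ring.
  by rewrite -[RHS]mulr1 -(cos2Dsin2 th); ring.
have t0 : t != 0 by rewrite -cmod_gt0 cmodM cmod_cis mulr1 cmod_real gtr0_norm.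
rewrite -/t; clearbody t.
have -> : k t = t^* / (t^* - a%:C).
  rewrite /k -tr -[X in X / _](mulrC t^*) [t * t^*]mulrC -mulrBl.
  by rewrite -mulf_div divff // mulr1.
have -> : t^* / (t^* - a%:C) = (t / (t - a%:C))^*.
  by rewrite -[in LHS](conjc_real a) rmorphM fmorphV rmorphB.
by rewrite conjcK.
Qed.

(** The difference quotient [q], completed at [a] by its limit, has [q 0 = 0], so its means tend to
    0. On the circle, adding [g a%:C] times the kernel gives the integrand. *)
Lemma cauchy_formula r a : 0 < a < r -> r < rho ->
  tends (fun N => circ N (fun t => g t * (t / (t - a%:C))) r) (g a%:C).
Proof.
move=> ar rrho; have /andP[a0 ar'] := ar; have r0 : 0 < r by lra.
have arho : cmod (a%:C : R[i]) < rho by rewrite cmod_real gtr0_norm //; lra.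
have [B hB] := differentiable_cdiff (dg (t := a%:C) arho).
pose q0 (t : cplx R) : cplx R := t * (g t - g a%:C) / (t - a%:C).
pose q t : R[i] := if t == a%:C then a%:C * B else q0 t.
have qa : ccont q a%:C.
  (* Near [a] one has [cmod u <= a + 1], which multiplies the error of the slope; the other half of
     [e] is for [(u - a%:C) * B]. *)
  move=> e e0; have [d d0 hd] := hB (Num.min 1 (e / (2 * (a + 1)))) ltac:(by
    rewrite lt_min ltr01 divr_gt0 //; lra).
  have B0 := cmod_ge0 B.
  exists (Num.min (Num.min 1 d) (e / (2 * (1 + cmod B)))).
    by rewrite !lt_min ltr01 d0 divr_gt0 //; lra.
  move=> u; rewrite !lt_min ltr_pdivlMr; last lra.
  move=> /andP[/andP[u1 ud] ue]; have {}hd := hd u ud.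
  rewrite /q eqxx; have [_|ua] := eqVneq u a%:C.
    by rewrite subrr cmod0 ltW.
  have ua0 : u - a%:C != 0 by rewrite subr_eq0.
  have -> : q0 u - a%:C * B =
      u * ((g u - g a%:C - B * (u - a%:C)) / (u - a%:C)) + (u - a%:C) * B.
    by rewrite /q0; field.
  have h1 : cmod ((g u - g a%:C - B * (u - a%:C)) / (u - a%:C)) <= e / (2 * (a + 1)).
    rewrite cmodM cmodV ler_pdivrMr ?cmod_gt0 //; apply: le_trans hd _.
    by rewrite ler_wpM2r ?cmod_ge0 // ge_min lexx orbT.
  have h2 : cmod u <= a + 1.
    have := cmodD (u - a%:C) a%:C; rewrite subrK cmod_real gtr0_norm //; lra.
  apply: le_trans (cmodD _ _) _; rewrite !(cmodM u) (cmodM (u - _)).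
  have h3 : cmod u * cmod ((g u - g a%:C - B * (u - a%:C)) / (u - a%:C)) <=
      (a + 1) * (e / (2 * (a + 1))).
    by rewrite ler_pM ?cmod_ge0.
  have : (a + 1) * (e / (2 * (a + 1))) = e / 2 by field; lra.
  nra.
have dq t : t != a%:C -> cmod t < rho -> cdiff q t.
  move=> ta trho.
  have [C hC] : cdiff q0 t.
    apply: differentiable_cdiff; apply: differentiableM.
      apply: differentiableM; first exact: ex_diff.
      by apply: differentiableB; [exact: dg|exact: differentiable_cst].
    apply: differentiableV; last by rewrite subr_eq0.
    by apply: differentiableB; [exact: ex_diff|exact: differentiable_cst].
  exists C => e /hC[d d0 hd].
  (* Within this radius [u] differs from [a], so [q] agrees with [q0]. *)
  exists (Num.min d (cmod (t - a%:C))).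
    by rewrite lt_min d0 cmod_gt0 subr_eq0.
  move=> u; rewrite lt_min => /andP[ud ua].
  have ua' : u != a%:C.
    by apply: contraTneq ua => ->; rewrite cmodB ltxx.
  by rewrite /q (negbTE ta) (negbTE ua'); exact: hd.
have a0' : a%:C != 0 :> R[i] by rewrite -cmod_gt0 cmod_real gtr0_norm.
have q00 : q 0 = 0 by rewrite /q eq_sym (negbTE a0') /q0 !mul0r.
have : tends (fun N => circ N q r) (q 0).
  apply: (mean_value a0 (rho := rho)); first by rewrite r0.
    by apply/cdiff_ccont/dq; [rewrite eq_sym|rewrite cmod0; lra].
  move=> t _ trho; have [->|ta] := eqVneq t a%:C; first by right.
  by left; exact: dq.
rewrite q00 => h; have := tendsD h (tendsZ (g a%:C) (kernel_mean ar)).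
rewrite add0r mulr1; apply: tends_ext => N.
rewrite /circ -dmeanZ -dmeanD; apply: dmean_eq => [|th _].
  by rewrite mulr_ge0 // pi_ge0.
set t := r%:C * cis th.
have tr : cmod t = r by rewrite cmodM cmod_cis mulr1 cmod_real gtr0_norm.
clearbody t.
have ta : t != a%:C.
  by apply: contra_eqN tr => /eqP ->; rewrite cmod_real gtr0_norm //; lra.
rewrite /q (negbTE ta) /q0; field.
by rewrite subr_eq0.
Qed.

End CauchyFormula.

(** * Taylor remainder and maximum principle in one variable *)

Section OneVariable.
Variable R : realType.
Variables (g : R[i] -> R[i]) (rho M : R).
Hypothesis dg : forall t : cplx R, cmod t < rho ->
  differentiable (g : cplx R -> cplx R) t.
Hypothesis gM : forall t : R[i], cmod t < rho -> cmod (g t) <= M.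
Implicit Types (t B : R[i]) (a b r : R) (N : nat).

Lemma cmod_subr_ge t r a : 0 <= a -> cmod t = r -> r - a <= cmod (t - a%:C).
Proof.
move=> a0 <-; have := cmodD (t - a%:C) a%:C.
by rewrite subrK cmod_real ger0_norm // lerBlDr.
Qed.

(** By Cauchy's formula the slope at [x] is the limit of means of [g t / (t - x)]. The difference of
    two such kernels has denominator [(t - a) * (t - b)], of modulus at least [(r / 2) ^+ 2]. *)
Lemma slope_lipschitz r a b : 0 < r < rho -> 0 < a <= r / 2 -> 0 < b <= r / 2 ->
  cmod ((g a%:C - g 0) / a%:C - (g b%:C - g 0) / b%:C) <= 4 * M / r ^+ 2 * `|a - b|.
Proof.
move=> /andP[r0 rrho] /andP[a0 ar] /andP[b0 br].
have nz x : 0 < x -> (x%:C : R[i]) != 0.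
  by move=> x0; rewrite -cmod_gt0 cmod_real gtr0_norm.
have M0 : 0 <= M.
  by apply: le_trans (gM (t := 0) _); rewrite ?cmod_ge0 // cmod0; lra.
have h0 : tends (fun N => circ N g r) (g 0).
  by apply: (mean_value_differentiable dg); rewrite r0.
have slope x : 0 < x <= r / 2 -> tends
    (fun N => circ N (fun t => g t / (t - x%:C)) r) ((g x%:C - g 0) / x%:C).
  move=> /andP[x0 xr].
  have xr' : 0 < x < r by lra.
  have := tendsZ (x%:C)^-1 (tendsB (cauchy_formula dg xr' rrho) h0).
  rewrite mulrC; apply: tends_ext => N.
  rewrite /circ -dmeanB -dmeanZ; apply: dmean_eq => [|th _].
    by rewrite mulr_ge0 // pi_ge0.
  set t := r%:C * cis th.
  have tr : cmod t = r by rewrite cmodM cmod_cis mulr1 cmod_real gtr0_norm.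
  clearbody t; have tx : t - x%:C != 0.
    by rewrite -cmod_gt0; have := cmod_subr_ge (ltW x0) tr; lra.
  by field; apply/andP; split=> //; exact: nz.
have := tendsB (slope a ltac:(lra)) (slope b ltac:(lra)).
move=> /tends_bound; apply => N; rewrite /circ -dmeanB.
apply: dmean_bound => [|th _]; first by rewrite mulr_ge0 // pi_ge0.
set t := r%:C * cis th.
have tr : cmod t = r by rewrite cmodM cmod_cis mulr1 cmod_real gtr0_norm.
clearbody t.
have ta := cmod_subr_ge (ltW a0) tr; have tb := cmod_subr_ge (ltW b0) tr.
have ta0 : t - a%:C != 0 by rewrite -cmod_gt0; lra.
have tb0 : t - b%:C != 0 by rewrite -cmod_gt0; lra.
have -> : g t / (t - a%:C) - g t / (t - b%:C) =
    g t * (a - b)%:C / ((t - a%:C) * (t - b%:C)).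
  by rewrite rmorphB; field; apply/andP; split.
rewrite !cmodM cmodV cmodM cmod_real.
have -> : 4 * M / r ^+ 2 * `|a - b| = M * `|a - b| * (r / 2 * (r / 2))^-1.
  by field; lra.
rewrite ler_pM ?invr_ge0 ?mulr_ge0 ?cmod_ge0 //.
  by rewrite ler_pM ?cmod_ge0 // gM // tr.
rewrite lef_pV2 ?posrE ?mulr_gt0 //; try lra.
by rewrite ler_pM //; lra.
Qed.

(** Let [b] tend to 0 in [slope_lipschitz]: the slope at [b] tends to [B]. The resulting constant
    depends on [g] only through [M]. *)
Lemma taylor1 r a B : 0 < r < rho -> 0 < a <= r / 2 ->
  (forall e : R, 0 < e -> exists2 d : R, 0 < d & forall b : R, 0 < b < d ->
    cmod (g b%:C - g 0 - B * b%:C) <= e * b) ->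
  cmod (g a%:C - g 0 - B * a%:C) <= 4 * M / r ^+ 2 * a ^+ 2.
Proof.
move=> rrho ar hB; have /andP[a0 _] := ar.
have r0 : 0 < r by case/andP: rrho.
have nz x : 0 < x -> (x%:C : R[i]) != 0.
  by move=> x0; rewrite -cmod_gt0 cmod_real gtr0_norm.
have M0 : 0 <= M.
  by apply: le_trans (gM (t := 0) _); rewrite ?cmod_ge0 // cmod0; lra.
have -> : g a%:C - g 0 - B * a%:C = ((g a%:C - g 0) / a%:C - B) * a%:C.
  by field; exact: nz.
rewrite cmodM cmod_real gtr0_norm // expr2 mulrA ler_pM2r //.
apply/ler_addgt0Pr => e /hB[d d0 hd].
pose b := Num.min (a / 2) (d / 2).
have [b0 ba bd] : [/\ 0 < b, b <= a / 2 & b <= d / 2].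
  by rewrite /b lt_min !ge_min !lexx orbT !divr_gt0.
have h1 := slope_lipschitz rrho ar (b := b) ltac:(lra).
have h2 : cmod ((g b%:C - g 0) / b%:C - B) <= e.
  have -> : (g b%:C - g 0) / b%:C - B = (g b%:C - g 0 - B * b%:C) / b%:C.
    by field; exact: nz.
  rewrite cmodM cmodV cmod_real gtr0_norm // ler_pdivrMr //.
  by apply: hd; lra.
have -> : (g a%:C - g 0) / a%:C - B = ((g a%:C - g 0) / a%:C -
  (g b%:C - g 0) / b%:C) + ((g b%:C - g 0) / b%:C - B) by ring.
apply: le_trans (cmodD _ _) _; apply: lerD h2; apply: le_trans h1 _.
apply: ler_wpM2l; last by rewrite ger0_norm; lra.
by apply: divr_ge0; [exact: mulr_ge0|exact: sqr_ge0].
Qed.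

(** The function [u] has mean 0, and Cauchy's formula bounds [u a] by [K] times the mean of [|u|].
    The latter is small because [|u| <= eta + |u| ^+ 2 / eta], with [|u| ^+ 2] bounded by a linear
    expression in [u]. *)
Lemma maximum_modulus a : 0 < a < rho -> cmod (g 0) = M -> g a%:C = g 0.
Proof.
move=> /andP[a0 arho] g0; set w := g 0 in g0 *.
pose r := (a + rho) / 2.
have [ar rrho] : a < r /\ r < rho by rewrite /r; split; lra.
have r0 : 0 < r by lra.
pose u (t : R[i]) : R[i] := w - g t.
have du (t : cplx R) : cmod t < rho -> differentiable (u : cplx R -> cplx R) t.
  by move=> ht; apply: differentiableB; [exact: differentiable_cst|exact: dg].
have h0 : tends (fun N => circ N u r) 0.
  have -> : 0 = u 0 by rewrite /u subrr.
  by apply: (mean_value_differentiable du); rewrite r0.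
have ha := cauchy_formula du (a := a) (r := r) ltac:(lra) rrho.
apply/esym/subr0_eq; rewrite -[LHS]/(u a%:C).
pose K := r / (r - a).
have K0 : 0 < K by rewrite divr_gt0 //; lra.
(* |u|^2 <= 2 Re (conj(w) u), so the mean of |u| is small with that of u. *)
have hu (t : R[i]) : cmod t < rho -> cmod (u t) ^+ 2 <= 2 * complex.Re (conjc w * u t).
  move=> /gM gtM; have {gtM} : cmod (g t) ^+ 2 <= cmod w ^+ 2.
    by rewrite ler_sqr ?nnegrE ?cmod_ge0 // g0.
  rewrite /u !cmod_sqr; move: (g t) (w) => [x y] [x' y'] /=; simpc => /=.
  lra.
apply: cmod_le_eps => e e0.
(* So [K * eta] is [e / 2]; each of the two limits below takes another [e / 4]. *)
pose eta := e / (2 * K).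
have eta0 : 0 < eta by rewrite divr_gt0 //; lra.
pose c : R[i] := (2 / eta)%:C * conjc w.
have [N1 h1] := ha (e / 4) ltac:(lra).
have [N2 h2] := tendsZ (K%:C * c) h0 (e := e / 4) ltac:(lra).
have {}h1 := h1 (N1 + N2)%N (leq_addr _ _).
have {}h2 := h2 (N1 + N2)%N (leq_addl _ _).
set N := (N1 + N2)%N in h1 h2.
set v := circ N _ r in h1; rewrite mulr0 subr0 in h2.
have hv : cmod v <= complex.Re (circ N (fun t => K%:C * (eta%:C + c * u t)) r).
  apply: dmean_cmod => [|th _]; first by rewrite mulr_ge0 // pi_ge0.
  set t := r%:C * cis th.
  have tr : cmod t = r by rewrite cmodM cmod_cis mulr1 cmod_real gtr0_norm.
  clearbody t.
  have ta := cmod_subr_ge (ltW a0) tr.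
  have trho : cmod t < rho by rewrite tr.
  have hut := hu t trho.
  have -> : complex.Re (K%:C * (eta%:C + c * u t)) =
      K * (eta + 2 * complex.Re (conjc w * u t) / eta).
    by rewrite /c Re_realM ReD -(mulrA _ (conjc w)) Re_realM /=; ring.
  have k1 : cmod (t / (t - a%:C)) <= K.
    rewrite cmodM cmodV tr /K ler_pM2l // lef_pV2 // posrE; lra.
  have k2 : cmod (u t) <= eta + 2 * complex.Re (conjc w * u t) / eta.
    apply: (@le_trans _ _ (eta + cmod (u t) ^+ 2 / eta)).
      rewrite -(ler_pM2r eta0) mulrDl divfK ?gt_eqF //.
      have := sqr_ge0 (cmod (u t) - eta); have := sqr_ge0 (cmod (u t)).
      by have := sqr_ge0 eta; rewrite sqrrB; nra.
    by rewrite lerD2l ler_pM2r ?invr_gt0.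
  by rewrite cmodM mulrC ler_pM ?cmod_ge0.
have {}hv : cmod v <= e / 2 + e / 4.
  apply: le_trans hv _.
  rewrite /circ dmeanZ dmeanD dmean_cst dmeanZ -/(circ N u r).
  rewrite mulrDr mulrA ReD; apply: lerD.
    by simpc => /=; rewrite /eta le_eqVlt; apply/orP; left; apply/eqP; field; lra.
  by apply: le_trans h2; apply: le_trans (ler_norm _) (Re_le_cmod _).
have -> : u a%:C = v - (v - u a%:C) by ring.
by apply: le_trans (cmodD _ _) _; rewrite cmodN; lra.
Qed.

End OneVariable.

(** * The Euclidean ball, the max norm, and complex lines *)

Section Ball.
Variables (R : realType) (n : nat).
Local Notation V := 'rV[cplx R]_n.
Implicit Types (z h : V) (t : cplx R) (F : V -> cplx R).

Definition rnorm h : R := complex.Re `|h|.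

Lemma rnormE h : `|h| = (rnorm h)%:C.
Proof.
have h0 : 0 <= `|h| by [].
by rewrite /rnorm; move: h0; case: `|h| => a b; rewrite lecE /= => /andP[/eqP -> _].
Qed.

Lemma rnorm_ge0 h : 0 <= rnorm h.
Proof. by rewrite -cplx_ler -rnormE normr_ge0. Qed.

Lemma rnormZ t h : rnorm (t *: h) = cmod t * rnorm h.
Proof. by apply: (@complexI R); rewrite rmorphM /= -!rnormE normrZ. Qed.

Lemma rnorm_eq0 h : rnorm h = 0 -> h = 0.
Proof. by move=> h0; apply/eqP; rewrite -normr_eq0 rnormE h0. Qed.

Lemma cmod_coord h j : cmod (h 0 j) <= rnorm h.
Proof.
suff : `|h 0 j| <= `|h| by rewrite rnormE cplx_norm cplx_ler.
rewrite [leRHS]/Num.Def.normr /= mx_normE -[leLHS]nngE num_le.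
exact: (le_bigmax _ (fun i => `|h i.1 i.2|%:nng) (0, j)).
Qed.

Definition sqnorm z : R := \sum_(j < n) cmod (z 0 j) ^+ 2.

Lemma cballE z : cball z <-> sqnorm z < 1.
Proof.
rewrite /cball /= -cplx_ltr /sqnorm rmorph_sum.
by under eq_bigr do rewrite cplx_norm -rmorphXn.
Qed.

(** The margin is uniform in [z], which later allows steps of fixed length along a segment. *)
Lemma cball_margin (sigma : R) : sigma < 1 -> exists2 rho, 0 < rho &
  forall z h, sqnorm z <= sigma -> rnorm h < rho -> cball (z + h).
Proof.
move=> s1.
have n0 : 0 <= n%:R :> R by exact: ler0n.
(* With [cmod (z 0 j) <= 1] and [rho <= 1], each squared coordinate grows by at most [3 * rho]; the
   extra 1 in the denominator makes the final inequality strict. *)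
pose rho := Num.min 1 ((1 - sigma) / (1 + 3 * n%:R)).
have [rho0 rho1 rhos] : [/\ 0 < rho, rho <= 1 & rho * (1 + 3 * n%:R) <= 1 - sigma].
  rewrite -ler_pdivlMr; last lra.
  by rewrite /rho lt_min !ge_min !lexx orbT ltr01 divr_gt0 //; lra.
exists rho => // z h zs hr; apply/cballE.
have zj j : cmod (z 0 j) <= 1.
  rewrite -(@ler_sqr _ _ 1) ?nnegrE ?cmod_ge0 // expr1n.
  apply: le_trans (le_trans zs (ltW s1)); rewrite /sqnorm (bigD1 j) //=.
  by rewrite lerDl sumr_ge0 // => i _; exact: sqr_ge0.
apply: (@le_lt_trans _ _ (\sum_(j < n) (cmod (z 0 j) ^+ 2 + 3 * rho))).
  apply: ler_sum => j _; rewrite mxE.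
  have := cmodD (z 0 j) (h 0 j); have := cmod_coord h j; have := zj j.
  have := cmod_ge0 (z 0 j); have := cmod_ge0 (h 0 j).
  by have := cmod_ge0 (z 0 j + h 0 j); nra.
rewrite big_split /= sumr_const card_ord -[_ *+ n]mulr_natr.
by move: zs; rewrite /sqnorm; nra.
Qed.

Lemma sqnorm_convex z h (x sigma : R) : 0 <= x <= 1 ->
  sqnorm z <= sigma -> sqnorm (z + h) <= sigma -> sqnorm (z + x%:C *: h) <= sigma.
Proof.
move=> /andP[x0 x1] zs hs.
apply: (@le_trans _ _ ((1 - x) * sqnorm z + x * sqnorm (z + h))); last by nra.
rewrite /sqnorm !mulr_sumr -big_split /=; apply: ler_sum => j _; rewrite !mxE.
rewrite !cmod_sqr; move: (z 0 j) (h 0 j) => [a b] [c d] /=; simpc => /=.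
have := sqr_ge0 c; have := sqr_ge0 d.
have : 0 <= x * (1 - x) by nra.
nra.
Qed.

Lemma line_differentiable F z h (rho : R) : analytic_on_ball F ->
  (forall t, cmod t < rho -> cball (z + t *: h)) ->
  forall t, cmod t < rho -> differentiable (fun t : cplx R => F (z + t *: h)) t.
Proof.
move=> aF zh t ht.
apply: (@differentiable_comp _ _ _ _ (fun t : cplx R => z + t *: h) F).
  apply: differentiableD; first exact: differentiable_cst.
  by apply: differentiableZl; exact: ex_diff.
exact/aF/zh.
Qed.

(** This is [taylor1] on the complex line through [z] in the unit direction [k] of [h], with radius
    [rho / 2] and bound 1. *)
Lemma taylor1_ball F z h (rho : R) : 0 < rho -> analytic_on_ball F ->
  (forall h, rnorm h < rho -> cball (z + h)) ->
  (forall z, cball z -> cmod (F z) <= 1) ->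
  rnorm h <= rho / 4 ->
  cmod (F (z + h) - F z - 'd F z h) <= 16 / rho ^+ 2 * rnorm h ^+ 2.
Proof.
move=> rho0 aF zrho F1 hrho.
have [/rnorm_eq0->|h0] := eqVneq (rnorm h) 0.
  rewrite addr0 linear0 subrr subr0 cmod0 mulr_ge0 ?sqr_ge0 //.
  by rewrite divr_ge0 ?sqr_ge0.
have a0 : 0 < rnorm h by rewrite lt_def h0 rnorm_ge0.
pose k : V := (rnorm h)^-1%:C *: h.
have nz : (rnorm h)%:C != 0 :> cplx R.
  by rewrite -rnormE normr_eq0; apply: contra_neq h0 => ->; rewrite /rnorm normr0.
have k1 : rnorm k = 1.
  by rewrite /k rnormZ cmod_real ger0_norm ?invr_ge0 ?rnorm_ge0 // mulVf.
have hk : h = (rnorm h)%:C *: k.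
  by rewrite /k scalerA fmorphV divff // scale1r.
clearbody k.
have zk (t : cplx R) : cmod t < rho -> cball (z + t *: k).
  by move=> ht; apply: zrho; rewrite rnormZ k1 mulr1.
have dg := line_differentiable aF zk.
have z0 : cball z by have := zk 0; rewrite scale0r addr0 cmod0; apply.
have := @taylor1 R (fun t => F (z + t *: k)) rho 1 dg
  (fun t ht => F1 _ (zk t ht)) (rho / 2) (rnorm h) ('d F z k).
rewrite scale0r addr0 -hk.
have -> : 'd F z h = 'd F z k * (rnorm h)%:C.
  by rewrite {1}hk linearZ /= mulrC.
have -> : 4 * 1 / (rho / 2) ^+ 2 = 16 / rho ^+ 2 by field; lra.
apply; [lra|lra|] => e e0.
have e0' : (0 : cplx R) < e%:C by rewrite cplx_ltr.
have [_ /cplx_gt0[d d0 ->] hd] := differentiable_le (aF z z0) e0'.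
exists d => // b /andP[b0 bd].
have := hd (z + b%:C *: k).
rewrite [z + _ - z]addrAC subrr add0r linearZ /= !rnormE rnormZ k1 mulr1.
rewrite cmod_real gtr0_norm // cplx_ltr => /(_ bd).
rewrite cplx_norm [X in _ <= X -> _](_ : _ = (e * b)%:C); last by rewrite rmorphM.
by rewrite cplx_ler [X in _ - X]mulrC.
Qed.

End Ball.

(** * Limits of bounded sequences along an ultrafilter *)

Section UltraLimit.
Variables (R : realType) (U : set_system nat).
Context {UU : UltraFilter U}.

Lemma ultralimit_real (u : nat -> R) (M : R) : (forall k, `|u k| <= M) ->
  exists l, forall e : R, 0 < e -> U [set k | `|u k - l| <= e].
Proof.
move=> uM.
have [|l [_ hl]] := @segment_compact R (- M) M (u @ U) (fmap_proper_filter _ _).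
  by apply: (@filterE _ U) => k; rewrite /= in_itv /= -ler_norml; exact: uM.
exists l => e e0.
(* An ultrafilter contains the set or its complement, and the complement would contradict that [l]
   is a cluster point. *)
have [//|nU] := in_ultra_setVsetC [set k | `|u k - l| <= e] UU.
have FA : (u @ U) (u @` (~` [set k | `|u k - l| <= e])).
  by apply: (@filterS _ U) nU => k hk; exists k.
have [_ [[k hk <-]]] := hl _ _ FA (nbhsx_ballx l e e0).
by move=> lk; case: hk; rewrite /= distrC ltW.
Qed.

Lemma ultralimit (u : nat -> R[i]) (M : R) : (forall k, cmod (u k) <= M) ->
  exists l, forall e : R, 0 < e -> U [set k | cmod (u k - l) <= e].
Proof.
move=> uM.
have [x hx] := @ultralimit_real (fun k => complex.Re (u k)) M
  (fun k => le_trans (Re_le_cmod _) (uM k)).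
have [y hy] := @ultralimit_real (fun k => complex.Im (u k)) M
  (fun k => le_trans (Im_le_cmod _) (uM k)).
exists (x +i* y) => e e0.
have hxy := @filterI _ U _ _ _ (hx (e / 2) ltac:(lra)) (hy (e / 2) ltac:(lra)).
apply: (@filterS _ U) hxy => k [/= h1 h2].
have -> : u k - (x +i* y) = (complex.Re (u k) - x) +i* (complex.Im (u k) - y).
  by case: (u k) => ? ?; simpc.
by apply: le_trans (cmod_Complex _ _) _; lra.
Qed.

Lemma ultra_le (u : nat -> R[i]) (l : R[i]) (M : R) :
  (forall e : R, 0 < e -> U [set k | cmod (u k - l) <= e]) ->
  U [set k | cmod (u k) <= M] -> cmod l <= M.
Proof.
move=> ul uM; apply/ler_addgt0Pr => e e0.
have [k [/= h1 h2]] := filter_ex (@filterI _ U _ _ _ (ul e e0) uM).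
by have := cmodD (u k) (- (u k - l)); rewrite cmodN opprB addrC subrK; lra.
Qed.

End UltraLimit.

(** * Montel's theorem and the maximum principle on the ball *)

Section BallTheory.
Variables (R : realType) (n : nat).
Local Notation V := 'rV[cplx R]_n.
Implicit Types (z h : V) (F f : V -> cplx R).

Lemma cball_rho z : cball z -> exists2 rho : R, 0 < rho &
  forall h, rnorm h < rho -> cball (z + h).
Proof.
move=> /cballE /(@cball_margin R n)[rho rho0 h].
by exists rho => // k; exact: h.
Qed.

(** Scale [h] to norm [rho / 4]: the Taylor remainder and the two values of [F] are each at most 1,
    so the differential is at most 3 there. *)
Lemma diff_bound F z h (rho : R) : 0 < rho -> analytic_on_ball F ->
  (forall h, rnorm h < rho -> cball (z + h)) ->
  (forall z, cball z -> cmod (F z) <= 1) ->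
  cmod ('d F z h) <= 12 / rho * rnorm h.
Proof.
move=> rho0 aF zrho F1.
have [/rnorm_eq0->|h0] := eqVneq (rnorm h) 0.
  by rewrite linear0 cmod0 mulr_ge0 ?divr_ge0 ?rnorm_ge0 // ltW.
have a0 : 0 < rnorm h by rewrite lt_def h0 rnorm_ge0.
pose c := rho / 4 / rnorm h.
have c0 : 0 < c by rewrite !divr_gt0.
have ck : rnorm (c%:C *: h) = rho / 4.
  by rewrite rnormZ cmod_real gtr0_norm // /c divfK.
have := @taylor1_ball R n F z (c%:C *: h) rho rho0 aF zrho F1.
rewrite ck => /(_ (lexx _)).
have -> : 16 / rho ^+ 2 * (rho / 4) ^+ 2 = 1 :> R by field; lra.
have h1 := F1 _ (zrho (c%:C *: h) ltac:(rewrite ck; lra)).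
have h2 : cmod (F z) <= 1.
  by apply: F1; rewrite -[z]addr0; apply: zrho; rewrite /rnorm normr0.
rewrite linearZ /=; set d := 'd F z h.
set A := F (z + _) in h1 *; rewrite -[c%:C *: d]/(c%:C * d : R[i]) => h3.
have : cmod (c%:C * d : R[i]) <= 3.
  have -> : c%:C * d = (A : R[i]) - F z - (A - F z - c%:C * d) by ring.
  apply: le_trans (cmodD _ _) _; rewrite cmodN.
  by have := cmodD (A : R[i]) (- (F z : R[i])); rewrite cmodN; lra.
rewrite cmodM cmod_real gtr0_norm // -ler_pdivlMl // /c.
by have -> : (rho / 4 / rnorm h)^-1 * 3 = 12 / rho * rnorm h by field; rewrite h0; lra.
Qed.

(** Values and differentials both converge pointwise along [U]. The limit [L] of the differentials
    is linear and bounded, and the uniform quadratic remainder passes to the limit, so [L] is the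
    differential of [f]. *)
Lemma montel (U : set_system nat) (UU : UltraFilter U) (F : nat -> V -> cplx R) :
  (forall k, analytic_on_ball (F k)) ->
  (forall k z, cball z -> cmod (F k z) <= 1) ->
  exists f, analytic_on_ball f /\ forall z, cball z ->
    forall e : R, 0 < e -> U [set k | cmod (F k z - f z) <= e].
Proof.
move=> aF F1.
have : forall z, exists l : R[i], cball z ->
    forall e : R, 0 < e -> U [set k | cmod (F k z - l) <= e].
  move=> z; have [zb|zb] := pselect (cball z); last by exists 0.
  have [l hl] := @ultralimit R U _ (fun k => F k z) 1 (fun k => F1 k z zb).
  by exists l.
move=> /choice[f hf]; exists f; split => // z zb.
have [rho rho0 zrho] := cball_rho zb.
have : forall h, exists l : R[i],
    forall e : R, 0 < e -> U [set k | cmod ('d (F k) z h - l) <= e].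
  move=> h; have [l hl] := @ultralimit R U _ (fun k => 'd (F k) z h)
    (12 / rho * rnorm h) (fun k => diff_bound h rho0 (aF k) zrho (F1 k)).
  by exists l.
move=> /choice[L hL].
have linL : linear (L : V -> cplx R).
  move=> a h k; apply/subr0_eq; apply: cmod_le_eps => e e0.
  pose c := e / (3 * (1 + cmod a)); have ca := cmod_ge0 a.
  have c0 : 0 < c by rewrite divr_gt0 //; lra.
  have [j [/= h1 [/= h2 h3]]] := filter_ex (@filterI _ U _ _ _ (hL (a *: h + k) _ c0)
    (@filterI _ U _ _ _ (hL h _ c0) (hL k _ c0))).
  move: h1; rewrite linearP /= => h1.
  have -> : L (a *: h + k) - (a *: L h + L k) =
     - ((a *: 'd (F j) z h + 'd (F j) z k) - L (a *: h + k)) +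
     (a * ('d (F j) z h - L h)) + ('d (F j) z k - L k).
    have E (x : cplx R) : a *: x = (a : R[i]) * (x : R[i]) :> R[i] by [].
    move: (L (a *: h + k)) (L h) (L k) ('d (F j) z h) ('d (F j) z k) => x1 x2 x3 x4 x5.
    by rewrite !E; ring.
  apply: le_trans (cmodD _ _) _.
  have := cmodD (- ((a *: 'd (F j) z h + 'd (F j) z k) - L (a *: h + k)))
     (a * ('d (F j) z h - L h)).
  rewrite cmodN cmodM => h4.
  have h5 : cmod a * cmod ('d (F j) z h - L h) <= cmod a * c by rewrite ler_wpM2l.
  have : e = 3 * (1 + cmod a) * c by rewrite /c; field; lra.
  by move: h4 h5 h1 h2 h3; nra.
pose Lm : {linear V -> cplx R} := HB.pack (L : V -> cplx R)
  (GRing.isLinear.Build _ _ _ _ _ linL).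
have Lbound h : cmod (Lm h) <= 12 / rho * rnorm h.
  apply: (ultra_le (hL h)); apply: (@filterE _ U) => k /=.
  exact: (diff_bound h rho0 (aF k) zrho (F1 k)).
have Lcont : continuous Lm.
  apply/linear_bounded_continuous/linear_boundedP.
  exists (12 / rho)%:C; split; first by apply/complex_realP; exists (12 / rho).
  move=> r hr h; apply: (@le_trans _ _ ((12 / rho)%:C * `|h|)).
    by rewrite rnormE cplx_norm -rmorphM cplx_ler.
  by rewrite ler_wpM2r // ltW.
apply: (le_differentiable Lcont) => e /cplx_gt0[{}e e0 ->].
have K0 : 0 < 16 / rho ^+ 2 by rewrite divr_gt0 // exprn_gt0.
(* The first bound is the range of [taylor1_ball]; the second makes the quadratic remainder at most
   [e * rnorm h]. *)
pose r := Num.min (rho / 4) (e / (16 / rho ^+ 2)).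
have [r0 r1 r2] : [/\ 0 < r, r <= rho / 4 & r <= e / (16 / rho ^+ 2)].
  by rewrite /r lt_min !ge_min !lexx orbT divr_gt0 //= divr_gt0 // divr_gt0 // exprn_gt0.
exists r%:C; first by rewrite cplx_ltr.
move=> y; rewrite rnormE cplx_ltr cplx_norm => yr.
rewrite [leRHS](_ : _ = (e * rnorm (y - z))%:C); last by rewrite rmorphM.
rewrite cplx_ler; set h := y - z in yr *.
have -> : y = z + h by rewrite /h addrC subrK.
have zhb : cball (z + h) by apply: zrho; lra.
apply: (@le_trans _ _ (16 / rho ^+ 2 * rnorm h ^+ 2)); last first.
  rewrite expr2 mulrA ler_wpM2r ?rnorm_ge0 // mulrC -ler_pdivlMr //.
  by apply: ltW; apply: lt_le_trans r2.
apply: (@ultra_le R U _ (fun k => F k (z + h) - F k z - 'd (F k) z h)).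
  move=> d d0.
  have hd := @filterI _ U _ _ _ (hf _ zhb (d / 3) ltac:(lra))
    (@filterI _ U _ _ _ (hf _ zb (d / 3) ltac:(lra)) (hL h (d / 3) ltac:(lra))).
  apply: (@filterS _ U) hd => k [/= h1 [/= h2 h3]].
  have -> : (F k (z + h) : R[i]) - F k z - 'd (F k) z h - (f (z + h) - f z - Lm h)
    = (F k (z + h) - f (z + h)) - (F k z - f z) - ('d (F k) z h - L h).
    by rewrite /Lm /=; ring.
  apply: le_trans (cmodD _ _) _; rewrite cmodN.
  have := cmodD (F k (z + h) - f (z + h) : R[i]) (- (F k z - f z)).
  by rewrite cmodN; lra.
apply: (@filterE _ U) => k /=; apply: (taylor1_ball rho0 (aF k) zrho (F1 k)); lra.
Qed.

(** The segment from [z] to [w] is covered in [K] equal steps. At each one the one-variable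
    principle carries the value of [f], hence its maximal modulus, to the next point. *)
Lemma maximum_modulus_ball f z w (M : R) : analytic_on_ball f ->
  (forall z, cball z -> cmod (f z) <= M) ->
  cball z -> cball w -> cmod (f z) = M -> f w = f z.
Proof.
move=> af fM zb wb fz.
pose sigma := Num.max (sqnorm z) (sqnorm w).
have s1 : sigma < 1 by rewrite gt_max; apply/andP; split; exact/cballE.
have [rho rho0 hrho] := @cball_margin R n sigma s1.
pose h := w - z.
have h0 := rnorm_ge0 h.
have zs : sqnorm z <= sigma by rewrite le_max lexx.
have ws : sqnorm (z + h) <= sigma by rewrite /h addrC subrK le_max lexx orbT.
(* The step [1 / K] stays below [rho / (rnorm h + 1)], a radius valid at all points of the segment;
   the added 1 covers [h = 0]. *)
have [K hK] : exists K : nat, (rnorm h + 1) / rho < K%:R.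
  by exists (Num.trunc ((rnorm h + 1) / rho)).+1; rewrite truncnS_gt.
have K0 : 0 < K%:R :> R by apply: lt_trans hK; rewrite divr_gt0 //; lra.
have step (x : R) : 0 <= x <= 1 ->
    cmod (f (z + x%:C *: h)) = M -> f (z + (x + K%:R^-1)%:C *: h) = f (z + x%:C *: h).
  move=> x01 fx; set p := z + x%:C *: h.
  have ps : sqnorm p <= sigma by exact: sqnorm_convex.
  have pb (t : cplx R) : cmod t < rho / (rnorm h + 1) -> cball (p + t *: h).
    rewrite ltr_pdivlMr; last lra.
    move=> ht; apply: hrho => //; rewrite rnormZ.
    by have := cmod_ge0 t; nra.
  have := @maximum_modulus R (fun t => f (p + t *: h)) _ M
    (line_differentiable af pb) (fun t ht => fM _ (pb t ht)) K%:R^-1.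
  rewrite scale0r addr0 => <-; [by rewrite rmorphD scalerDl addrA| |exact: fx].
  rewrite invr_gt0 K0 /= ltr_pdivlMr; last lra.
  by rewrite mulrC ltr_pdivrMr // mulrC -ltr_pdivrMr.
have {}step k : (k <= K)%N -> f (z + (k%:R / K%:R)%:C *: h) = f z.
  elim: k => [_|k IH kK]; first by rewrite mul0r scale0r addr0.
  have {}IH := IH (ltnW kK).
  rewrite -natr1 mulrDl mul1r step ?IH //.
  by rewrite divr_ge0 ?ler0n //= ler_pdivrMr // mul1r ler_nat ltnW.
have := step K (leqnn K); rewrite divff ?gt_eqF // scale1r /h addrC subrK.
by [].
Qed.

End BallTheory.

(** * The supremum norm *)

Section SupNorm.
Variables (R : realType) (n : nat).
Implicit Types (f : 'rV[cplx R]_n -> cplx R).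

Lemma cball0 : @cball R n 0.
Proof.
by apply/cballE; rewrite /sqnorm big1 // => j _; rewrite mxE cmod0 expr0n.
Qed.

Lemma cmod_le_supnorm f z : bounded_on_ball f -> cball z -> cmod (f z) <= supnorm f.
Proof.
move=> [M hM] zb; apply: ub_le_sup; last by exists z.
by exists M => _ [x xb <-]; exact: hM.
Qed.

Lemma supnorm_le f (M : R) : (forall z, cball z -> cmod (f z) <= M) -> supnorm f <= M.
Proof.
move=> fM; apply: ge_sup; first by exists (complex.Re `|f 0|), 0 => //; exact: cball0.
by move=> _ [x xb <-]; exact: fM.
Qed.

Lemma supnorm_ge0 f : bounded_on_ball f -> 0 <= supnorm f.
Proof. by move=> bf; apply: le_trans (cmod_le_supnorm bf cball0); exact: cmod_ge0. Qed.

Lemma bounded_on_ballP f (M : R) :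
  (forall z, cball z -> cmod (f z) <= M) -> bounded_on_ball f.
Proof. by move=> fM; exists M. Qed.

Lemma analytic_scale f (c : cplx R) : analytic_on_ball f ->
  analytic_on_ball (fun x => c * f x).
Proof. by move=> af z zb; apply: differentiableZ; exact: af. Qed.

Lemma supnorm_scale f (c : R) : 0 <= c -> bounded_on_ball f ->
  supnorm (fun x => c%:C * f x) <= c * supnorm f.
Proof.
move=> c0 bf; apply: supnorm_le => z zb.
by rewrite cmodM cmod_real ger0_norm // ler_wpM2l // cmod_le_supnorm.
Qed.

End SupNorm.

(** * Existence of a minimal interpolant *)

Section Interpolation.
Variables (R : realType) (n m : nat).
Variables (z : 'I_m -> 'rV[cplx R]_n) (w : 'I_m -> cplx R).
Hypothesis zb : forall i, cball (z i).

Lemma lambda_inf_le f : interpolants z w f -> lambda_inf z w <= supnorm f.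
Proof.
move=> hf; apply: ge_inf; last by exists f.
by exists 0 => _ [g [[[_ bg] _] _] <-]; exact: supnorm_ge0.
Qed.

Lemma lambda_inf_attained : interpolants z w !=set0 ->
  exists f, [/\ analytic_on_ball f,
    forall x, cball x -> cmod (f x) <= lambda_inf z w & forall i, f (z i) = w i].
Proof.
move=> [f0 hf0]; set lam := lambda_inf z w.
have has : has_inf [set supnorm f | f in interpolants z w].
  split; first by exists (supnorm f0), f0.
  by exists 0 => _ [g [[[_ bg] _] _] <-]; exact: supnorm_ge0.
have : forall k : nat, exists f, interpolants z w f /\ supnorm f < lam + k.+1%:R^-1.
  move=> k; have k0 : 0 < k.+1%:R^-1 :> R by rewrite invr_gt0.
  have [_ [f hf <-] lt] := inf_adherent k0 has.
  by exists f.
move=> /choice[F hF].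
(* [U] refines the eventual filter, so estimates valid for large [k] hold along [U]. *)
have [U [UU Uoo]] := ultraFilterLemma eventually_filter.
have aF k : analytic_on_ball (F k) by have [[[[]]]] := hF k.
have bF k : bounded_on_ball (F k) by have [[[[]]]] := hF k.
have F1 k x : cball x -> cmod (F k x) <= 1.
  move=> xb; apply: le_trans (cmod_le_supnorm (bF k) xb) _.
  by have [[[]]] := hF k.
have [f [af hf]] := montel UU aF F1.
exists f; split => // [x xb|i].
  apply/ler_addgt0Pr => e e0.
  apply: (ultra_le (hf x xb)); apply: Uoo.
  have := near_infty_natSinv_lt (PosNum e0).
  apply: filterS => k /= ke; apply: le_trans (cmod_le_supnorm (bF k) xb) _.
  by have [_ /ltW /le_trans] := hF k; apply; rewrite lerD2l ltW.
apply/esym/subr0_eq; apply: cmod_le_eps => e e0.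
have [k /=] := filter_ex (hf _ (zb i) e e0).
by have [[_ ->]] := hF k.
Qed.

End Interpolation.

(** * Extremality of the rescaled minimal interpolant *)

Theorem theorem10 (R : realType) (n m : nat) (hn : (1 <= n)%N) (hm : (1 < m)%N)
    (z : 'I_m -> 'rV[cplx R]_n) (w : 'I_m -> cplx R)
    (hzw : pick_data z w)
    (hw : exists i j : 'I_m, w i <> w j)
    (hS : interpolants z w !=set0) :
  exists phi : 'rV[cplx R]_n -> cplx R,
    extremal phi /\
    interpolants z w (fun x => (lambda_inf z w)%:C * phi x).
Proof.
case: hzw => zinj zb w1.
have [f [af fle fw]] := lambda_inf_attained zb hS.
set lam := lambda_inf z w in fle *.
have lam1 : lam <= 1.
  by case: hS => g hg; apply: le_trans (lambda_inf_le hg) _; case: hg => [[]].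
(* Equality would make [f] attain its bound inside the ball, hence be constant there, and so would
   be [w]. *)
have wlt i : cmod (w i) < lam.
  rewrite lt_neqAle -{2}fw fle // andbT; apply/eqP => wi.
  have const j : w j = w i.
    by rewrite -!fw; apply: (maximum_modulus_ball af fle); rewrite // fw.
  by case: hw => j [k]; rewrite !const.
have lam0 : 0 < lam by apply: le_lt_trans (cmod_ge0 _) (wlt (Ordinal (ltnW hm))).
have lamC : lam%:C != 0 :> cplx R.
  by rewrite -(cmod_eq0 lam%:C) cmod_real gtr0_norm // gt_eqF.
pose phi x : cplx R := lam^-1%:C * f x.
have lamK (u : cplx R) : lam%:C * (lam^-1%:C * u) = u.
  by rewrite fmorphV mulVKf.
have phi_le x : cball x -> cmod (phi x) <= 1.
  move=> xb; rewrite cmodM cmod_real gtr0_norm ?invr_gt0 //.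
  by rewrite ler_pdivrMl // mulr1 fle.
have phiS : schur phi.
  split; last exact: supnorm_le.
  by split; [exact: analytic_scale|exact: bounded_on_ballP phi_le].
pose v i : cplx R := lam^-1%:C * w i.
have phiv : interpolants z v phi by split => // i; rewrite /phi fw.
exists phi; split; last first.
  have -> : (fun x => lam%:C * phi x) = f by apply/funext => x; exact: lamK.
  split => //; split; last by apply: supnorm_le => x /fle /le_trans; exact.
  by split => //; exact: bounded_on_ballP fle.
exists m, z, v; split => //.
  split => // i; rewrite cplx_norm cplx_ltr cmodM cmod_real ger0_norm.
    by rewrite ltr_pdivrMl // mulr1 wlt.
  by rewrite invr_ge0 ltW.
split; first by exists phi.
(* As [lam * g] interpolates [w], [lam] is at most its norm, which is at most [lam * supnorm g];
   dividing by [lam] gives [1 <= supnorm g]. *)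
move=> g [[[ag bg] g1] gv]; apply/eqP; rewrite eq_le g1 /=.
have scaled : supnorm (fun x => lam%:C * g x) <= lam * supnorm g.
  by apply: supnorm_scale => //; exact: ltW.
rewrite -(ler_pM2l lam0) mulr1; apply: (le_trans _ scaled).
apply: lambda_inf_le; split; last by move=> i; rewrite gv lamK.
split; last by apply: le_trans scaled _; rewrite mulr_ile1 ?supnorm_ge0 ?(ltW lam0).
split; first exact: analytic_scale.
apply: (@bounded_on_ballP _ _ _ (lam * supnorm g)) => x xb.
by rewrite cmodM cmod_real gtr0_norm // ler_pM2l // cmod_le_supnorm.
Qed.
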